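(* Let $n\ge 1$ be an integer, let $\alpha>0$ and $\beta>1$ be real numbers, and let $q$ be a real number with $q>\max\{\beta,\, n(\beta-1)/\alpha\}$. Let $u\in L^{q}(\mathbf{R}^{n})$ be a positive solution of the integral equation $$u=g_{\alpha}\ast u^{\beta}\quad\text{on } \mathbf{R}^n,$$ where $g_\alpha$ is the Bessel kernel. Then $u$ is radially symmetric and monotone decreasing about some point; that is, there exist a point $x_0\in\mathbf{R}^n$ and a monotone decreasing function $\varphi$ (meaning $\varphi(r)\ge\varphi(s)$ whenever $r\le s$) such that $u(x)=\varphi(|x-x_0|)$ for all $x\in\mathbf{R}^n$.
   Context: For $\alpha>0$, the Bessel kernel on $\mathbf{R}^n$ is $$g_{\alpha}(x)=\frac{1}{\gamma(\alpha)}\int_{0}^{\infty}\exp(-\pi|x|^{2}/\delta)\exp(-\delta/4\pi)\,\delta^{(-n+\alpha)/2}\,\frac{d\delta}{\delta},\qquad \gamma(\alpha)=(4\pi)^{\alpha/2}\Gamma(\alpha/2).$$ The symbol $\ast$ denotes convolution on $\mathbf{R}^n$. A positive solution of $u=g_\alpha\ast u^\beta$ is a measurable function $u:\mathbf{R}^n\to(0,\infty)$ such that $u(x)=\int_{\mathbf{R}^n}g_\alpha(x-y)\,u(y)^\beta\,dy$ for every $x\in\mathbf{R}^n$. *)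

(* Defs.v *)
From HB Require Import structures.
From mathcomp Require Import all_boot all_order all_algebra.
From mathcomp Require Import all_classical all_reals all_analysis.
From mathcomp Require Import measurable_realfun.

Set Implicit Arguments.
Unset Strict Implicit.
Unset Printing Implicit Defensive.
Import Order.TTheory GRing.Theory Num.Theory.
Import numFieldNormedType.Exports.

Local Open Scope classical_set_scope.
Local Open Scope ring_scope.

Definition measure_rV_display : measure_display.
Proof. exact. Qed.

(* The Borel sigma-algebra of R^n, generated by the coordinate maps. *)
Section measurable_rV.
Context (R : realType) (n : nat).

Let coor (i : 'I_n) (x : 'rV[R]_n) : measurableTypeR R := x 0 i.

Let rV_set0 : g_sigma_preimage coor set0.
Proof. exact: sigma_algebra0. Qed.

Let rV_setC A : g_sigma_preimage coor A -> g_sigma_preimage coor (~` A).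
Proof. exact: sigma_algebraC. Qed.

Let rV_bigcup (F : _^nat) : (forall i, g_sigma_preimage coor (F i)) ->
  g_sigma_preimage coor (\bigcup_i (F i)).
Proof. exact: sigma_algebra_bigcup. Qed.

HB.instance Definition _ := @isMeasurable.Build measure_rV_display 'rV[R]_n
  (g_sigma_preimage coor) rV_set0 rV_setC rV_bigcup.

End measurable_rV.

Section measurable_rV_lemmas.
Context (R : realType) (n : nat).

Lemma measurable_coor (i : 'I_n) :
  measurable_fun [set: 'rV[R]_n] (fun x => x 0 i : measurableTypeR R).
Proof.
move=> _ Y mY; rewrite setTI; apply: sub_sigma_algebra => /=.
rewrite -bigcup_seq/=; exists i => /=; first by rewrite mem_index_enum.
by exists Y => //; rewrite setTI.
Qed.

Lemma measurable_fun_rV d (T : measurableType d) (f : T -> 'rV[R]_n) :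
  (forall i, measurable_fun setT (fun t => f t 0 i : measurableTypeR R)) ->
  measurable_fun setT f.
Proof.
move=> mf _ Y; rewrite setTI /measurable/= => /(_ (image_set_system setT f measurable)).
rewrite /image_set_system /= setTI; apply; split.
  exact/sigma_algebra_image/sigma_algebra_measurable.
rewrite -bigcup_seq/= => A [i _ [B mB <-]]; rewrite /= !setTI.
by have := mf i measurableT _ mB; rewrite setTI.
Qed.

End measurable_rV_lemmas.

Section lebesgue_rV.
Context {R : realType}.
Local Open Scope ereal_scope.

Definition rV_cons n (p : measurableTypeR R * 'rV[R]_n) : 'rV[R]_n.+1 :=
  row_mx (p.1%:M : 'rV_1) p.2.

Lemma rV_cons0 n p : @rV_cons n p 0%R ord0 = p.1.
Proof.
rewrite mxE; case: splitP => [j _|//].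
by rewrite (ord1 j) mxE eqxx mulr1n.
Qed.

Lemma rV_consS n p i : @rV_cons n p 0%R (lift ord0 i) = p.2 0%R i.
Proof.
rewrite mxE; case: splitP => [j|j /= [ij]]; first by rewrite (ord1 j).
by congr (p.2 0%R _); apply/val_inj.
Qed.

Lemma measurable_rV_cons n : measurable_fun setT (@rV_cons n).
Proof.
apply: measurable_fun_rV => i; case: (unliftP ord0 i) => [j|] ->.
- under eq_fun do rewrite rV_consS.
  exact: (measurableT_comp (measurable_coor j) measurable_snd).
- by under eq_fun do rewrite rV_cons0; exact: measurable_fst.
Qed.

(* Lebesgue measure on R^n as the n-fold product of the one-dimensional one;
   R^0 is a point of mass 1. *)
Fixpoint lebesgue_rV n : set 'rV[R]_n -> \bar R :=
  match n with
  | 0%N => dirac (0%R : 'rV[R]_0)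
  | m.+1 => pushforward (lebesgue_measure \x @lebesgue_rV m) (@rV_cons m)
  end.
Arguments lebesgue_rV : clear implicits.

Let packed n : exists m : {sigma_finite_measure set 'rV[R]_n -> \bar R},
  lebesgue_rV n = m.
Proof.
elim: n => [|n [m mE]] /=.
  by exists (dirac (0%R : 'rV[R]_0)).
rewrite mE; set mu := pushforward _ _.
have mmu : isMeasure _ _ _ mu.
  pose P : {measure set _ -> \bar R} := lebesgue_measure \x m.
  have p0 : mu set0 = 0 by rewrite /mu /pushforward preimage_set0 (measure0 P).
  have pge0 A : 0 <= mu A by exact: (measure_ge0 P).
  have psa : semi_sigma_additive mu.
    move=> F mF tF mUF; rewrite /mu /pushforward preimage_bigcup.
    have mcons A : measurable A -> measurable (@rV_cons n @^-1` A).
      by move=> mA; rewrite -[X in measurable X]setTI; exact: measurable_rV_cons.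
    apply: (measure_semi_sigma_additive (s := P)).
    - by move=> k; exact: mcons.
    - apply/trivIsetP => /= i j _ _ ij; rewrite -preimage_setI.
      by move/trivIsetP : tF => /(_ _ _ _ _ ij) ->//; rewrite preimage_set0.
    - by rewrite -preimage_bigcup; exact: mcons.
  exact: (isMeasure.Build _ _ _ mu p0 pge0 psa).
have smu : sigma_finite setT mu.
  have [F TF Foo] : sigma_finite setT (@lebesgue_measure R \x m).
    have /sigma_finiteP[F [TF ndF Foo]] := sigma_finiteT (@lebesgue_measure R).
    have /sigma_finiteP[G [TG ndG Goo]] := sigma_finiteT m.
    exists (fun k => F k `*` G k).
      rewrite -setXTT TF TG predeqE => -[x y]; split.
        move=> [/= [i _ Fix] [j _ Gjy]]; exists (maxn i j) => //; split.
        - by move: x Fix; exact/subsetPset/ndF/leq_maxl.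
        - by move: y Gjy; exact/subsetPset/ndG/leq_maxr.
      by move=> [k _ []/= ? ?]; split; exists k.
    move=> k; have [? ?] := Foo k; have [? ?] := Goo k.
    split; first exact: measurableX.
    by rewrite product_measure1E// lte_mul_pinfty// ge0_fin_numE.
  pose c (x : 'rV[R]_n.+1) : measurableTypeR R * 'rV[R]_n :=
    (x 0%R ord0, \row_i x 0%R (lift ord0 i))%R.
  have mc : measurable_fun setT c.
    apply/measurable_fun_pairP; split; first exact: measurable_coor.
    apply: measurable_fun_rV => i /=.
    under eq_fun do rewrite mxE.
    exact: measurable_coor.
  have cK p : c (@rV_cons n p) = p.
    case: p => a b; rewrite /c rV_cons0; congr (_, _).
    by apply/rowP => i; rewrite mxE rV_consS.
  exists (fun k => c @^-1` F k); first by rewrite -preimage_bigcup -TF.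
  move=> k; have [mF Fk] := Foo k; split.
    by rewrite -[X in measurable X]setTI; exact: mc.
  rewrite /mu /pushforward -comp_preimage.
  by rewrite (_ : c \o _ = id) ?preimage_id//; apply/funext => p; exact: cK.
move: mu mmu smu => mu mmu smu.
pose M : {measure set 'rV[R]_n.+1 -> \bar R} := HB.pack mu mmu.
have sM := @Measure_isSigmaFinite.Build _ _ _ M smu.
pose M' : {sigma_finite_measure set 'rV[R]_n.+1 -> \bar R} :=
  HB.pack mu mmu sM.
by exists M'.
Qed.

Let lebesgue_rV0 n : lebesgue_rV n set0 = 0.
Proof. by have [m ->] := packed n. Qed.

Let lebesgue_rV_ge0 n A : 0 <= lebesgue_rV n A.
Proof. by have [m ->] := packed n. Qed.

Let lebesgue_rV_semi_sigma_additive n : semi_sigma_additive (lebesgue_rV n).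
Proof. by have [m ->] := packed n; exact: measure_semi_sigma_additive. Qed.

HB.instance Definition _ n := isMeasure.Build _ _ _ (lebesgue_rV n)
  (@lebesgue_rV0 n) (@lebesgue_rV_ge0 n) (@lebesgue_rV_semi_sigma_additive n).

Let lebesgue_rV_sigma_finite n : sigma_finite setT (lebesgue_rV n).
Proof. by have [m ->] := packed n; exact: sigma_finiteT. Qed.

HB.instance Definition _ n := Measure_isSigmaFinite.Build _ _ _ (lebesgue_rV n)
  (@lebesgue_rV_sigma_finite n).

Lemma lebesgue_rV_box n (A : 'I_n -> set (measurableTypeR R)) :
  (forall i, measurable (A i)) ->
  lebesgue_rV n [set x | forall i, A i (x 0%R i)] =
  \big[*%E/1]_(i < n) lebesgue_measure (A i).
Proof.
elim: n A => [|n IH] A mA.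
  rewrite big_ord0 /= /dirac indicE (_ : _ \in _ = true)//.
  by apply/mem_set => -[].
rewrite big_ord_recl/= /pushforward.
pose B := [set x : 'rV[R]_n | forall i, A (lift ord0 i) (x 0%R i)].
rewrite (_ : _ @^-1` _ = A ord0 `*` B); last first.
  apply/seteqP; split => -[a b] /=.
    move=> h; split; first by have := h ord0; rewrite rV_cons0.
    by move=> i; have := h (lift ord0 i); rewrite rV_consS.
  move=> [ha hb] i; case: (unliftP ord0 i) => [j|] ->.
    by rewrite rV_consS; exact: hb.
  by rewrite rV_cons0.
have mB : measurable B.
  rewrite (_ : B = \bigcap_(i in [set: 'I_n])
      ((fun x : 'rV[R]_n => x 0%R i : measurableTypeR R) @^-1` A (lift ord0 i))).
    apply: fin_bigcap_measurable => // i _.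
    by rewrite -[X in measurable X]setTI; exact: measurable_coor.
  by apply/seteqP; split => x /= h i; [move=> _; exact: h|exact: (h i I)].
rewrite product_measure1E//; congr (_ * _).
exact: (IH (fun i => A (lift ord0 i))).
Qed.

End lebesgue_rV.
Arguments lebesgue_rV {R} n.

(* Lebesgue, not merely Borel, measurability.  The library integral of a
   nonnegative function is a supremum over Borel simple functions below it, so
   it is the usual Lebesgue integral on all Lebesgue measurable ones. *)
Definition lebesgue_measurable_fun (R : realType) n (u : 'rV[R]_n -> R) :=
  forall Y : set R, measurable Y ->
    completed_algebra_gen (lebesgue_rV n) (u @^-1` Y).

Lemma borel_lebesgue_measurable_fun (R : realType) n (u : 'rV[R]_n -> R) :
  measurable_fun setT u -> lebesgue_measurable_fun u.
Proof.
move=> mu Y mY; exists (u @^-1` Y); first by rewrite -[X in _ X]setTI; exact: mu.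
by exists set0; [exact: negligible_set0|rewrite setU0].
Qed.

Definition in_Lp (R : realType) n (p : R) (u : 'rV[R]_n -> R) :=
  lebesgue_measurable_fun u /\ finite_norm (lebesgue_rV n) p%:E u.

(* The library norm on row vectors is the sup norm. *)
Definition enorm (R : realType) n (x : 'rV[R]_n) : R :=
  Num.sqrt (\sum_(i < n) x 0 i ^+ 2).

Definition Gamma (R : realType) (s : R) : R :=
  \int[lebesgue_measure]_(t in `]0, +oo[) (t `^ (s - 1) * expR (- t)).

Definition bessel_gamma (R : realType) (alpha : R) : R :=
  (4 * pi) `^ (alpha / 2) * Gamma (alpha / 2).

(* Extended-real valued: the kernel is +oo at the origin when alpha <= n. *)
Definition bessel_kernel (R : realType) n (alpha : R) (x : 'rV[R]_n) : \bar R :=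
  (((bessel_gamma alpha)^-1)%:E * \int[lebesgue_measure]_(delta in `]0%R, +oo[)
    (expR (- (pi * enorm x ^+ 2 / delta)) * expR (- (delta / (4 * pi)))
      * delta `^ ((- n%:R + alpha) / 2) / delta)%R%:E)%E.

Definition convolution (R : realType) n (f g : 'rV[R]_n -> \bar R)
    (x : 'rV[R]_n) : \bar R :=
  (\int[lebesgue_rV n]_y (f (x - y)%R * g y))%E.

Definition positive_solution (R : realType) n (alpha beta : R)
    (u : 'rV[R]_n -> R) :=
  [/\ lebesgue_measurable_fun u,
      forall x, 0 < u x &
      forall x, (u x)%:E =
        convolution (bessel_kernel alpha) (fun y => (u y `^ beta)%:E) x].

(* Main.v *)
Require Import Defs.
From HB Require Import structures.
From mathcomp Require Import all_boot all_order all_algebra.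
From mathcomp Require Import all_classical all_reals all_analysis.
From mathcomp Require Import measurable_realfun ring lra.
Set Implicit Arguments.
Unset Strict Implicit.
Unset Printing Implicit Defensive.
Import Order.TTheory GRing.Theory Num.Theory.
Import numFieldNormedType.Exports.
Local Open Scope classical_set_scope.
Local Open Scope ring_scope.

(** Moving planes in integral form.  For a half-space [x . e < l] with reflection [r], put
    [w = (u - u \o r)^+] there.  Folding the equation along the plane gives
    [w <= C g * (u^(beta-1) w)], and since the plane's excess set [A] carries little of
    [\int u^q] when [l] is near -oo, the kernel [C g(x-y) u(y)^(beta-1)] has mass at most 1/2
    over [A] (Young's inequality against the Gaussians of which [g] is a mixture; this is
    where [q > n (beta-1) / alpha] enters), which forces [w = 0].  So [u <= u \o r] for [l]
    near -oo.  By Fatou's lemma [u] is lower semicontinuous, which suffices to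
    carry the inequality up to a critical [l], and past it unless [u = u \o r] there.
    A positive function in L^q has no period, so all critical planes pass through one
    point, and comparing two points across their bisecting plane concludes. *)

(** The function u is only Lebesgue measurable, and g may be +oo at the origin. Comparisons are
    therefore obtained almost everywhere and become pointwise when inserted under the integral in
    the equation; where g may be infinite, inequalities are written as sums, without subtraction.

    The inequality for w cannot be integrated directly against u^(beta-1): u in L^q does not control
    u^beta where u is small. This forces a truncation of w at a level c > 0, and beta < q makes the
    truncated integral finite.

    With theta = (beta-1)/q, the power 1/theta of u^(beta-1) is u^q, and the conjugate norm of the
    Gaussian exp(-pi |x|^2 / t) grows like t^(n(1-theta)/2). The mixing weight times this power is
    integrable near t = 0 exactly when (alpha - n(beta-1)/q)/2 > 0: this is the condition on q.

    In each limit of planes, one of the two compared points stays fixed and only the one with the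
    larger value moves. Hence semicontinuity from below, along lines, can replace continuity. *)

Section lebesgue_rV_integral.
Context {R : realType}.
Local Open Scope ereal_scope.
Implicit Types (n : nat).

(** * Translation invariance and iterated integrals on R^n *)

Lemma ge0_integral_lebesgueD (a : R) (f : R -> \bar R) :
  measurable_fun setT f -> (forall x, 0 <= f x) ->
  \int[lebesgue_measure]_x f (x + a)%R = \int[lebesgue_measure]_x f x.
Proof.
move=> mf f0.
have ma : measurable_fun setT (fun x : measurableTypeR R => x + a : measurableTypeR R)%R.
  exact: measurable_funD.
rewrite -[LHS](@ge0_integral_pushforward _ _ _ _ _ _ ma lebesgue_measure setT f)//.
apply: eq_measure_integral => //= A mA _; apply/esym.
pose maE := isMeasurableFun.Build _ _ _ _ _ ma.
pose aE : {mfun measurableTypeR R >-> measurableTypeR R} :=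
  HB.pack (fun x : measurableTypeR R => x + a : measurableTypeR R)%R maE.
apply: (@lebesgue_measure_unique _ (pushforward lebesgue_measure aE)) => //= _ [[c d]] _ <-.
rewrite /pushforward /=.
have -> : (fun x => (x + a)%R) @^-1` `]c, d]%classic = `](c - a)%R, (d - a)%R]%classic.
  by apply/seteqP; split => x /=; rewrite !in_itv/= ltrBlDr lerBrDr.
rewrite !lebesgue_measure_itv/= !lte_fin ltrD2r; case: ifPn => // _.
by rewrite -!EFinD; congr EFin; ring.
Qed.

Lemma ge0_integral_rV_cons n (f : 'rV[R]_n.+1 -> \bar R) :
  measurable_fun setT f -> (forall x, 0 <= f x) ->
  \int[lebesgue_rV n.+1]_x f x =
  \int[lebesgue_measure]_a \int[lebesgue_rV n]_y f (rV_cons (a, y)).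
Proof.
move=> mf f0.
have mc := @measurable_rV_cons R n.
transitivity (\int[pushforward (lebesgue_measure \x lebesgue_rV n) (@rV_cons R n)]_x f x).
  by [].
rewrite (@ge0_integral_pushforward _ _ _ _ _ _ mc)//= preimage_setT.
rewrite (fubini_tonelli1 (f \o @rV_cons R n))//=.
exact: measurableT_comp.
Qed.

Lemma measurable_rV_consr n (a : R) :
  measurable_fun setT (fun y : 'rV[R]_n => rV_cons (a, y)).
Proof.
apply: measurable_fun_rV => i; case: (unliftP ord0 i) => [j|] ->.
- by under eq_fun do rewrite rV_consS; exact: measurable_coor.
- by under eq_fun do rewrite rV_cons0; exact: measurable_cst.
Qed.

Lemma measurable_rVD n (a : 'rV[R]_n) :
  measurable_fun setT (fun x : 'rV[R]_n => x + a)%R.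
Proof.
apply: measurable_fun_rV => i; under eq_fun do rewrite mxE.
by apply: measurable_funD => //; exact: measurable_coor.
Qed.

Lemma ge0_integral_rVD n (a : 'rV[R]_n) (f : 'rV[R]_n -> \bar R) :
  measurable_fun setT f -> (forall x, 0 <= f x) ->
  \int[lebesgue_rV n]_x f (x + a)%R = \int[lebesgue_rV n]_x f x.
Proof.
elim: n a f => [|n IH] a f mf f0.
  by apply: eq_integral => x _; congr f; apply/rowP => -[].
pose a0 := a 0%R ord0; pose a' : 'rV[R]_n := (\row_i a 0 (lift ord0 i))%R.
have aE b y : (rV_cons (b, y) + a = rV_cons (b + a0, y + a'))%R.
  apply/rowP => i; rewrite mxE; case: (unliftP ord0 i) => [j|] ->.
    by rewrite !rV_consS /= !mxE.
  by rewrite !rV_cons0.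
rewrite !ge0_integral_rV_cons//; last exact: measurableT_comp (measurable_rVD a).
under eq_integral => b _.
  under eq_integral do rewrite aE.
  rewrite (IH a' (fun y => f (rV_cons ((b + a0)%R, y)))); last 2 first.
  - by apply: measurableT_comp => //; exact: measurable_rV_consr.
  - by [].
  over.
apply: (@ge0_integral_lebesgueD a0
  (fun b => \int[lebesgue_rV n]_y f (rV_cons (b, y)))).
- apply: (@measurable_fun_fubini_tonelli_F _ _ _ _ _ (lebesgue_rV n)
    (f \o @rV_cons R n)) => [|b]; last exact: f0.
  by apply: measurableT_comp => //; exact: measurable_rV_cons.
- by move=> b; apply: integral_ge0.
Qed.

End lebesgue_rV_integral.

(** * Euclidean inner product and measurability of vector operations *)

Section dot.
Context {R : realType} {n : nat}.
Implicit Types (x y z : 'rV[R]_n) (c : R).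

Definition dot x y : R := \sum_i x 0 i * y 0 i.

Lemma dotC x y : dot x y = dot y x.
Proof. by apply: eq_bigr => i _; rewrite mulrC. Qed.

Lemma dotDl x y z : dot (x + y) z = dot x z + dot y z.
Proof. by rewrite -big_split; apply: eq_bigr => i _; rewrite mxE mulrDl. Qed.

Lemma dotDr x y z : dot z (x + y) = dot z x + dot z y.
Proof. by rewrite !(dotC z) dotDl. Qed.

Lemma dotZl c x y : dot (c *: x) y = c * dot x y.
Proof. by rewrite mulr_sumr; apply: eq_bigr => i _; rewrite mxE mulrA. Qed.

Lemma dotZr c x y : dot x (c *: y) = c * dot x y.
Proof. by rewrite dotC dotZl dotC. Qed.

Lemma dotNl x y : dot (- x) y = - dot x y.
Proof. by rewrite -scaleN1r dotZl mulN1r. Qed.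

Lemma dotNr x y : dot x (- y) = - dot x y.
Proof. by rewrite dotC dotNl dotC. Qed.

Definition dotE := (dotDl, dotDr, dotNl, dotNr, dotZl, dotZr).

Lemma dot_ge0 x : 0 <= dot x x.
Proof. by apply: sumr_ge0 => i _; rewrite -expr2 sqr_ge0. Qed.

Lemma dot_eq0 x : (dot x x == 0) = (x == 0).
Proof.
apply/idP/eqP => [|->]; last first.
  by apply/eqP; apply: big1 => i _; rewrite mxE mul0r.
rewrite psumr_eq0 => [|i _]; last by rewrite -expr2 sqr_ge0.
move=> /allP h; apply/rowP => i; rewrite mxE.
by have := h i (mem_index_enum _); rewrite -expr2 sqrf_eq0 => /eqP.
Qed.

Lemma enorm_sqr x : enorm x ^+ 2 = dot x x.
Proof.
rewrite sqr_sqrtr; first by apply: eq_bigr => i _; rewrite expr2.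
by apply: sumr_ge0 => i _; exact: sqr_ge0.
Qed.

Lemma measurable_dot d (T : measurableType d) (f g : T -> 'rV[R]_n) :
  measurable_fun setT f -> measurable_fun setT g ->
  measurable_fun setT (fun t => dot (f t) (g t)).
Proof.
move=> mf mg; apply: measurable_sum => i; apply: measurable_funM.
- exact: (measurableT_comp (measurable_coor i) mf).
- exact: (measurableT_comp (measurable_coor i) mg).
Qed.

Lemma measurable_addrV d (T : measurableType d) (f g : T -> 'rV[R]_n) :
  measurable_fun setT f -> measurable_fun setT g ->
  measurable_fun setT (fun t => f t + g t).
Proof.
move=> mf mg; apply: measurable_fun_rV => i; under eq_fun do rewrite mxE.
apply: measurable_funD.
- exact: (measurableT_comp (measurable_coor i) mf).
- exact: (measurableT_comp (measurable_coor i) mg).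
Qed.

Lemma measurable_scalerV d (T : measurableType d) (c : T -> R) (g : T -> 'rV[R]_n) :
  measurable_fun setT c -> measurable_fun setT g ->
  measurable_fun setT (fun t => c t *: g t).
Proof.
move=> mf mg; apply: measurable_fun_rV => i; under eq_fun do rewrite mxE.
apply: measurable_funM => //.
exact: (measurableT_comp (measurable_coor i) mg).
Qed.

Lemma measurable_opprV d (T : measurableType d) (f : T -> 'rV[R]_n) :
  measurable_fun setT f -> measurable_fun setT (fun t => - f t).
Proof.
move=> mf; under eq_fun do rewrite -scaleN1r.
by apply: measurable_scalerV => //; exact: measurable_cst.
Qed.

Lemma measurable_subrV d (T : measurableType d) (f g : T -> 'rV[R]_n) :
  measurable_fun setT f -> measurable_fun setT g ->
  measurable_fun setT (fun t => f t - g t).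
Proof. by move=> mf mg; apply: measurable_addrV => //; exact: measurable_opprV. Qed.

End dot.

(** * Gaussian integrals *)

Section gaussian.
Context {R : realType}.
Local Open Scope ereal_scope.

Definition gaussian n (a : R) (x : 'rV[R]_n) : R := expR (- (a * dot x x)).

Lemma measurable_gaussian n a : measurable_fun setT (@gaussian n a).
Proof.
apply: measurableT_comp => //; apply: measurableT_comp => //.
by apply: measurable_funM => //; apply: measurable_dot.
Qed.

Lemma integral_gaussian_R (a : R) : (0 < a)%R ->
  \int[lebesgue_measure]_x (expR (- (a * x ^+ 2)))%:E = ((pi / a) `^ 2^-1)%:E.
Proof.
(* The standard deviation for which the centred normal density has exponent [- (a * x ^+ 2)]; its
   total mass 1 then yields the integral. *)
move=> a0; pose s := Num.sqrt (2 * a)^-1.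
have s0 : s != 0%R by rewrite gt_eqF// sqrtr_gt0 invr_gt0 mulr_gt0.
have s2 : (s ^+ 2 = (2 * a)^-1)%R.
  by rewrite sqr_sqrtr// invr_ge0 mulr_ge0// ltW.
have := integral_normal_pdf 0 s; rewrite normal_pdfE//.
under eq_integral do rewrite EFinM.
rewrite ge0_integralZl//=; last 3 first.
- by apply/measurable_EFinP; exact: measurable_normal_fun.
- by move=> x _; rewrite lee_fin normal_fun_ge0.
- by rewrite lee_fin normal_peak_ge0.
rewrite /normal_peak -powR12_sqrt; last first.
  by rewrite mulrn_wge0// mulr_ge0 ?pi_ge0// sqr_ge0.
have -> : (s ^+ 2 * pi *+ 2 = pi / a)%R by rewrite s2 -mulr_natr; field; rewrite gt_eqF.
have -> : \int[lebesgue_measure]_x (normal_fun 0 s x)%:E =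
  \int[lebesgue_measure]_x (expR (- (a * x ^+ 2)))%:E.
  apply: eq_integral => x _; rewrite /normal_fun subr0 s2; congr ((expR _)%:E).
  by rewrite -mulr_natr; field; rewrite gt_eqF.
have pa : (0 < (pi / a) `^ 2^-1)%R by rewrite powR_gt0// divr_gt0// pi_gt0.
move=> /(congr1 (fun z => (((pi / a) `^ 2^-1)%R)%:E * z)).
by rewrite muleA -EFinM divff ?gt_eqF// mul1e mule1.
Qed.

Lemma dot_rV_cons n (b : R) (y : 'rV[R]_n) :
  dot (rV_cons (b, y)) (rV_cons (b, y)) = (b ^+ 2 + dot y y)%R.
Proof.
rewrite /dot big_ord_recl rV_cons0 expr2; congr (_ + _)%R.
by apply: eq_bigr => i _; rewrite rV_consS.
Qed.

Lemma integral_gaussian n (a : R) : (0 < a)%R ->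
  \int[lebesgue_rV n]_x (gaussian a x)%:E = ((pi / a) `^ (n%:R / 2))%:E.
Proof.
move=> a0; elim: n => [|n IH].
  rewrite /= integral_dirac//; last first.
    by apply/measurable_EFinP; exact: measurable_gaussian.
  rewrite diracT mul1e /gaussian /dot big_ord0 mulr0 oppr0 expR0 mul0r powRr0//.
rewrite ge0_integral_rV_cons//; last 2 first.
- by apply/measurable_EFinP; exact: measurable_gaussian.
- by move=> x; rewrite lee_fin expR_ge0.
have inner b : \int[lebesgue_rV n]_y (gaussian a (rV_cons (b, y)))%:E =
    (expR (- (a * b ^+ 2)))%:E * ((pi / a) `^ (n%:R / 2))%:E.
  rewrite -IH -ge0_integralZl//=.
  - by apply: eq_integral => y _; rewrite /gaussian dot_rV_cons mulrDr opprD expRD.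
  - by apply/measurable_EFinP; exact: measurable_gaussian.
  - by move=> y _; rewrite lee_fin expR_ge0.
under eq_integral do rewrite inner.
rewrite ge0_integralZr ?integral_gaussian_R//; first last.
- by rewrite lee_fin powR_ge0.
- apply/measurable_EFinP; apply: measurableT_comp => //.
  by apply: measurableT_comp => //; apply: measurable_funM.
rewrite -EFinM -powRD; last first.
  by rewrite gt_eqF ?implybT// divr_gt0// pi_gt0.
by congr ((_ `^ _)%:E); rewrite -natr1; field.
Qed.

End gaussian.

Lemma mule_fin_gt0_inj (R : realType) (c : R) (x y : \bar R) : 0 < c ->
  (x * c%:E = y * c%:E)%E -> x = y.
Proof.
move=> c0 /(congr1 (fun z => z * (c^-1)%:E)%E).
by rewrite -!muleA -!EFinM divff ?gt_eqF// !mule1.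
Qed.

(** * Invariance under isometric involutions; hyperplanes are null *)

Section isometry.
Context {R : realType} {n : nat}.
Local Open Scope ereal_scope.
Implicit Types (f : 'rV[R]_n -> \bar R).
Local Notation mu := (@lebesgue_rV R n).

(* Both sides of [\int f * \int g = \int (f \o T) * \int g], for g Gaussian, are the
   integral of [f (x + T y) * g y] over R^n x R^n. *)
Lemma ge0_integral_isometry (T : 'rV[R]_n -> 'rV[R]_n) f :
  measurable_fun setT T -> {morph T : x y / (x + y)%R} -> involutive T ->
  (forall x, dot (T x) (T x) = dot x x) ->
  measurable_fun setT f -> (forall x, 0 <= f x) ->
  \int[mu]_x f (T x) = \int[mu]_x f x.
Proof.
have c0 : (0 < (pi / 1) `^ (n%:R / 2) :> R)%R.
  by rewrite powR_gt0// divr_gt0// pi_gt0.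
move=> mT TD TK dotT mf f0; pose g := @gaussian R n 1.
have mg : measurable_fun setT (EFin \o g).
  by apply/measurable_EFinP; exact: measurable_gaussian.
have g0 x : 0 <= (EFin \o g) x by rewrite lee_fin expR_ge0.
have intg := @integral_gaussian R n 1 ltr01.
pose F z := f (z.1 + T z.2)%R * (g z.2)%:E.
have F0 z : 0 <= F z by rewrite mule_ge0//; exact: g0.
have mF : measurable_fun setT F.
  apply: emeasurable_funM.
    apply: measurableT_comp => //; apply: measurable_addrV => //.
    exact: measurableT_comp.
  exact: (measurableT_comp mg).
have E1 : \int[mu]_y \int[mu]_x F (x, y) =
    \int[mu]_x f x * ((pi / 1) `^ (n%:R / 2))%:E.
  rewrite -intg -(ge0_integralZl mu measurableT mg (fun x _ => g0 x)); last first.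
    by apply: integral_ge0 => x _; exact: f0.
  apply: eq_integral => y _; rewrite /F /=.
  have mfT : measurable_fun setT (fun x : 'rV[R]_n => f (x + T y)%R).
    by apply: measurableT_comp => //; exact: measurable_rVD.
  rewrite (ge0_integralZr mu measurableT mfT (fun x _ => f0 _) (g0 y)).
  by rewrite (ge0_integral_rVD (T y)).
(* This is [F] with y translated by [- T x], so that x occurs only in the Gaussian and can be
   integrated out. *)
pose F' z := f (T z.2) * (g (z.1 - T z.2))%:E.
have F'0 z : 0 <= F' z by rewrite mule_ge0//; exact: g0.
have mF' : measurable_fun setT F'.
  apply: emeasurable_funM.
    by apply: measurableT_comp => //; exact: measurableT_comp.
  apply: (measurableT_comp mg); apply: measurable_subrV => //.
  exact: measurableT_comp.
have E2 : \int[mu]_x \int[mu]_y F (x, y) = \int[mu]_x \int[mu]_y F' (x, y).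
  apply: eq_integral => x _.
  have mFx : measurable_fun setT (fun y : 'rV[R]_n => F' (x, y)).
    exact: measurableT_comp.
  rewrite -(ge0_integral_rVD (T x) mFx (fun y => F'0 _)).
  apply: eq_integral => y _; rewrite /F /F' /=.
  have -> : (T (y + T x) = x + T y)%R by rewrite TD TK addrC.
  suff -> : g (x - (x + T y))%R = g y by [].
  rewrite /g /gaussian opprD addrA subrr add0r dotNl dotNr opprK dotT//.
have E3 : \int[mu]_y \int[mu]_x F' (x, y) =
    \int[mu]_x f (T x) * ((pi / 1) `^ (n%:R / 2))%:E.
  have mfT : measurable_fun setT (f \o T) by exact: measurableT_comp.
  rewrite -intg -(ge0_integralZr mu measurableT mfT (fun x _ => f0 _)); last first.
    by apply: integral_ge0 => x _; exact: g0.
  apply: eq_integral => y _; rewrite /F' /=.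
  have mgT : measurable_fun setT (fun x : 'rV[R]_n => (g (x - T y)%R)%:E).
    by apply: (measurableT_comp mg); exact: measurable_rVD.
  rewrite (ge0_integralZl mu measurableT mgT (fun x _ => g0 _) (f0 _)).
  by rewrite (ge0_integral_rVD (- T y)%R (f := EFin \o g)).
apply: (mule_fin_gt0_inj c0).
have T1 := @fubini_tonelli _ _ _ _ R mu mu F mF F0.
have T2 := @fubini_tonelli _ _ _ _ R mu mu F' mF' F'0.
exact: (etrans (esym E3) (etrans (esym T2) (etrans (esym E2) (etrans T1 E1)))).
Qed.

Lemma measurable_dotl (e : 'rV[R]_n) :
  measurable_fun setT (fun x : 'rV[R]_n => dot x e).
Proof. exact: measurable_dot. Qed.

(** Integrate the indicator of the hyperplane, shifted by [t *: e], over all t and all x. For each t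
    the x-integral is the measure sought; for each x a single t contributes, so the t-integral is 0.
    Thus the measure times the infinite length of the line is 0. *)
Lemma lebesgue_rV_hyperplane (e : 'rV[R]_n) (l : R) : dot e e = 1%R ->
  mu [set x | dot x e = l] = 0.
Proof.
move=> e1; set H := [set x | _].
have mH : measurable H.
  by have := measurable_dotl e measurableT (measurable_set1 l); rewrite setTI.
pose F (z : measurableTypeR R * 'rV[R]_n) : \bar R := (\1_H (z.2 + (- z.1) *: e)%R)%:E.
have F0 z : 0 <= F z by rewrite lee_fin.
have mF : measurable_fun setT F.
  apply/measurable_EFinP; apply: measurableT_comp => //.
  apply: measurable_addrV => //; apply: measurable_scalerV => //.
  exact: measurableT_comp.
have := @fubini_tonelli _ _ _ _ R lebesgue_measure mu F mF F0.
under eq_integral => t _.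
  rewrite /F /= (ge0_integral_rVD (- t *: e)%R (f := fun x => (\1_H x)%:E)).
  - rewrite integral_indic// setIT; over.
  - exact/measurable_EFinP.
  - by move=> x; rewrite lee_fin.
rewrite integral_cst//= [X in _ = X]integral0_eq.
  move/eqP; rewrite mule_eq0 => /orP[/eqP//|/eqP].
  have -> : [set: R] = `]-oo, +oo[%classic by rewrite set_itvE.
  by rewrite lebesgue_measure_itv.
move=> x _; rewrite /F /=.
have -> : (fun t : R => (\1_H (x + - t *: e)%R)%:E : \bar R) =
    (fun t => (\1_[set (dot x e - l)%R] t)%:E).
  apply/funext => t; congr EFin; rewrite /indic; congr (_%:R).
  have [->|tl] := eqVneq t (dot x e - l)%R.
    by rewrite !mem_set//= /H /= !dotE e1; ring.
  rewrite !memNset//=; first exact/eqP.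
  by rewrite /H /= !dotE e1 => h; move/eqP : tl; apply; rewrite -h; ring.
by rewrite integral_indic// setIT; exact: lebesgue_measure_set1.
Qed.

End isometry.

(** * Reflections and folding of integrals along a hyperplane *)

Section reflection.
Context {R : realType} {n : nat}.
Implicit Types (x y : 'rV[R]_n).
Variables (e : 'rV[R]_n) (l : R).
Hypothesis e1 : dot e e = 1.

Definition reflection x : 'rV[R]_n := x - (2 * (dot x e - l)) *: e.

Lemma dot_reflection x : dot (reflection x) e = 2 * l - dot x e.
Proof. by rewrite /reflection !dotE e1; ring. Qed.

Lemma reflectionK : involutive reflection.
Proof.
move=> x; rewrite {1}/reflection dot_reflection {1}/reflection -addrA -opprD.
rewrite -scalerDl.
have -> : 2 * (dot x e - l) + 2 * (2 * l - dot x e - l) = 0 by ring.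
by rewrite scale0r subr0.
Qed.

(** For x and y strictly on one side of the plane the last product is positive; every comparison of
    the kernel at [x - y] and at [reflection x - y] rests on this sign. *)
Lemma dist_reflection x y :
  dot (reflection x - y) (reflection x - y) =
  dot (x - y) (x - y) + 4 * ((l - dot x e) * (l - dot y e)).
Proof.
rewrite /reflection !dotE e1 (dotC e x) (dotC e y) (dotC y x); ring.
Qed.

Lemma dist_reflectionr x y :
  dot (x - reflection y) (x - reflection y) =
  dot (reflection x - y) (reflection x - y).
Proof.
rewrite /reflection !dotE e1 (dotC e x) (dotC e y) (dotC y x); ring.
Qed.

Lemma dist_reflection2 x y :
  dot (reflection x - reflection y) (reflection x - reflection y) =
  dot (x - y) (x - y).
Proof. by rewrite dist_reflectionr reflectionK. Qed.

Lemma measurable_reflection : measurable_fun setT reflection.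
Proof.
apply: measurable_subrV => //; apply: measurable_scalerV => //.
apply: measurable_funM => //; apply: measurable_funB => //.
exact: measurable_dotl.
Qed.

Local Open Scope ereal_scope.
Local Notation mu := (@lebesgue_rV R n).

Definition halfspace := [set x | (dot x e < l)%R].

Lemma measurable_halfspace : measurable halfspace.
Proof.
have := measurable_dotl e measurableT (measurable_itv `]-oo, l[).
by rewrite setTI; congr (measurable _); apply/seteqP; split => x /=;
  rewrite in_itv.
Qed.

End reflection.

Section reflection_integral.
Context {R : realType} {n : nat}.
Variables (e : 'rV[R]_n) (l : R).
Hypothesis e1 : dot e e = 1.
Local Open Scope ereal_scope.
Local Notation mu := (@lebesgue_rV R n).

Lemma ge0_integral_reflection (f : 'rV[R]_n -> \bar R) :
  measurable_fun setT f -> (forall x, 0 <= f x) ->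
  \int[mu]_x f (reflection e l x) = \int[mu]_x f x.
Proof.
move=> mf f0.
(* Invariance is available for additive maps, so the reflection is split into the one in the
   parallel plane through the origin and a translation. *)
have rE x : (reflection e l x = reflection e 0 x + (2 * l) *: e)%R.
  rewrite /reflection.
  have -> : (2 * (dot x e - l) = 2 * (dot x e - 0) - 2 * l)%R by ring.
  by rewrite scalerBl opprD opprK addrA.
under eq_integral do rewrite rE.
rewrite (ge0_integral_isometry (T := reflection e 0) (f := fun x => f (x + (2 * l) *: e)%R)).
- exact: ge0_integral_rVD.
- exact: measurable_reflection.
- move=> x y; rewrite /reflection dotDl !subr0 mulrDr scalerDl opprD.
  by rewrite addrACA.
- exact: reflectionK.
- move=> x; have := dist_reflection2 0 e1 x 0.
  by rewrite /reflection !dotE e1 (dotC e x) => _; ring.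
- by apply: measurableT_comp => //; exact: measurable_rVD.
- by move=> x; exact: f0.
Qed.

Lemma ge0_integral_halfspace (f : 'rV[R]_n -> \bar R) :
  measurable_fun setT f -> (forall x, 0 <= f x) ->
  \int[mu]_x f x = \int[mu]_(x in halfspace e l) (f x + f (reflection e l x)).
Proof.
move=> mf f0; have mS := measurable_halfspace e l.
have mfr : measurable_fun setT (f \o reflection e l).
  by apply: measurableT_comp => //; exact: measurable_reflection.
rewrite ge0_integralD//; last 2 first.
- exact: measurable_funTS.
- exact: measurable_funTS.
rewrite -{1}(setUv (halfspace e l)) ge0_integral_setU//; last 3 first.
- exact: measurableC.
- by rewrite setUv.
- exact/disj_setPCl.
congr (_ + _); rewrite integral_mkcond [RHS]integral_mkcond.
rewrite -[LHS]ge0_integral_reflection; last 2 first.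
- by apply/(measurable_restrictT _ (measurableC mS)); exact: measurable_funTS.
- by move=> x; apply: erestrict_ge0.
(* The two restricted functions can differ only on the plane itself, which is null. *)
apply: ge0_ae_eq_integral => //.
- apply: measurableT_comp; last exact: measurable_reflection.
  by apply/(measurable_restrictT _ (measurableC mS)); exact: measurable_funTS.
- by apply/(measurable_restrictT _ mS); exact: measurable_funTS.
- by move=> x _; apply: erestrict_ge0.
- by move=> x _; apply: erestrict_ge0.
exists [set x | dot x e = l]; split.
- by have := measurable_dotl e measurableT (measurable_set1 l); rewrite setTI.
- exact: lebesgue_rV_hyperplane.
move=> x /= h; apply: contrapT => xl; apply: h => _.
have [xl'|xl'] := ltP (dot x e) l.
  rewrite !patchE !mem_set// /setC /halfspace/= dot_reflection//.
  by apply/negP; rewrite -leNgt; lra.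
have {}xl' : (l < dot x e)%R by rewrite lt_neqAle xl' andbT eq_sym; apply/eqP.
rewrite !patchE !memNset// /setC /halfspace/= ?dot_reflection//.
  by apply/negP; rewrite -leNgt ltW.
by apply; lra.
Qed.

End reflection_integral.


(** * Measure-theoretic facts and elementary inequalities *)

Section measure_facts.
Context d (T : measurableType d) (R : realType) (mu : {measure set T -> \bar R}).
Local Open Scope ereal_scope.

Lemma negligible_integral_eq0 (D : set T) (f : T -> \bar R) :
  measurable D -> measurable_fun D f -> (forall x, D x -> 0 <= f x) ->
  \int[mu]_(x in D) f x = 0 -> mu.-negligible [set x | D x /\ f x <> 0].
Proof.
move=> mD mf f0 If; have /(ae_eq_integral_abs mu mD mf) : \int[mu]_(x in D) `|f x| = 0.
  by rewrite -[RHS]If; apply: eq_integral => x /set_mem Dx; rewrite gee0_abs// f0.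
by apply: negligibleS => x [Dx fx0] h; exact/fx0/h.
Qed.

(** Dominated convergence for [h] restricted to [E k], with [h] itself as the bound; the
    restrictions tend to 0 because almost every point eventually leaves the sets. *)
Lemma integral_vanishing_sets (h : T -> \bar R) (E : (set T)^nat) (eta : R) :
  measurable_fun setT h -> (forall x, 0 <= h x) -> \int[mu]_x h x < +oo ->
  (forall k, measurable (E k)) ->
  {ae mu, forall x, \forall k \near \oo, ~ E k x} -> (0 < eta)%R ->
  exists k, \int[mu]_(x in E k) h x <= eta%:E.
Proof.
move=> mh h0 hoo mE Ex eta0.
have ih : mu.-integrable setT h.
  apply/integrableP; split => //; rewrite (le_lt_trans _ hoo)//.
  by rewrite (eq_integral h)// => x _; rewrite gee0_abs.
have mf k : measurable_fun setT (h \_ (E k)).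
  by apply/(measurable_restrictT _ (mE k)); exact: measurable_funTS.
have cvg0 : {ae mu, forall x, setT x -> (h \_ (E k)) x @[k --> \oo] --> (cst 0 x : \bar R)}.
  apply: filterS Ex => x Ex _; apply: cvg_near_cst.
  by apply: filterS Ex => k Ekx; rewrite patchE memNset.
have dom : {ae mu, forall x k, setT x -> `|(h \_ (E k)) x| <= h x}.
  apply: aeW => x k _; rewrite patchE; case: ifPn => _; first by rewrite gee0_abs.
  by rewrite abse0.
have [_ _] := dominated_convergence measurableT mf (@measurable_cst _ _ _ _ _ _) cvg0 ih dom.
rewrite (_ : \int[mu]_x (cst 0 x) = 0 :> \bar R); last by rewrite integral0.
move=> /fine_cvgP[If_fin] /cvgr_lt /(_ eta eta0) If_lt.
have [k _ Hk] := filterI If_fin If_lt.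
have [kfin klt] := Hk k (leqnn k).
exists k; rewrite integral_mkcond; move: kfin klt => /= kfin klt.
by rewrite -(fineK kfin) lee_fin ltW.
Qed.

End measure_facts.

(** For finite [a] and [a'] this reads (a - a')(p - p') <= a b. It is stated with sums because [a]
    and [a'] will be values of the kernel, possibly +oo. *)
Lemma rearrangement_le (R : realType) (a a' : \bar R) (p p' b : R) :
  (0 <= a')%E -> (a' <= a)%E -> 0 < p -> 0 < p' -> 0 <= b -> p - p' <= b ->
  (a * p%:E + a' * p'%:E <= a' * p%:E + a * p'%:E + a * b%:E)%E.
Proof.
move=> a'0 a'a p0 p'0 b0 pb; have a0 : (0 <= a)%E := le_trans a'0 a'a.
case: a => [a||]// in a'a a0 *; last first.
  have X0 : (0 <= a' * p%:E)%E by rewrite mule_ge0// lee_fin ltW.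
  have Y0 : (0 <= (+oo : \bar R) * b%:E)%E by rewrite mule_ge0// lee_fin.
  apply: (@le_trans _ _ (+oo * p'%:E)%E); first by rewrite [leRHS]gt0_mulye ?lte_fin// leey.
  by apply: (le_trans (leeDr _ X0)); exact: leeDl.
case: a' => [a'||]// in a'0 a'a *.
rewrite -!EFinM -!EFinD; rewrite !lee_fin in a'0 a'a a0 *.
have [pp'|pp'] := leP p p'; nra.
Qed.

(** A mean value inequality with constant [N] in place of [beta]. Divided by u^beta it becomes 1 -
    t^beta <= N (1 - t) with t = v / u <= 1; since t^N <= t^beta, Bernoulli's inequality for the
    integer exponent [N] suffices. *)
Lemma powRB_le (R : realType) (beta u v : R) (N : nat) :
  beta <= N%:R -> 0 < v -> v <= u ->
  u `^ beta - v `^ beta <= N%:R * (u `^ (beta - 1) * (u - v)).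
Proof.
move=> bN v0 vu; have u0 : 0 < u by exact: lt_le_trans vu.
have bern (t : R) : 0 <= t <= 1 -> 1 - t ^+ N <= N%:R * (1 - t).
  move=> /andP[t0 t1]; elim: N {bN} => [|N IH]; first by rewrite expr0 mul0r subrr.
  rewrite -natr1 mulrDl mul1r.
  have -> : 1 - t ^+ N.+1 = t * (1 - t ^+ N) + (1 - t) by rewrite exprS; ring.
  rewrite lerD2r; apply: le_trans IH; rewrite ler_piMl//.
  by rewrite subr_ge0 exprn_ile1.
pose t := v / u.
have t01 : 0 < t <= 1 by rewrite divr_gt0//= ler_pdivrMr// mul1r.
have vE : v = t * u by rewrite /t divfK// gt_eqF.
have tN : t ^+ N <= t `^ beta.
  have t0 : 0 <= t by case/andP: t01 => /ltW.
  by rewrite -powR_mulrn//; exact: ger_powR.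
rewrite {1}vE powRM; [|by apply: ltW; case/andP: t01|exact: ltW].
have -> : u `^ beta - t `^ beta * u `^ beta = u `^ beta * (1 - t `^ beta) by ring.
have -> : N%:R * (u `^ (beta - 1) * (u - v)) = u `^ beta * (N%:R * (1 - t)).
  have -> : u `^ beta = u `^ (beta - 1) * u.
    rewrite -[X in _ * X](powRr1 (ltW u0)) -powRD; first by rewrite subrK.
    by rewrite (gt_eqF u0) implybT.
  by rewrite {1}vE; ring.
apply: ler_wpM2l; first exact: powR_ge0.
apply: le_trans (bern t _); first by rewrite lerB.
by case/andP: t01 => /ltW -> ->.
Qed.

(** The interface between the analysis of the kernel and the moving planes. [ks_g_lt] is guarded by
    finiteness because of the possible pole. The bound in [ks_small] is uniform in the centre x.
    [ks_lsc] is asked along lines only: the images of a point under reflections in parallel planes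
    lie on a line. *)
Record kernel_solution (R : realType) n (g : 'rV[R]_n -> \bar R)
    (u : 'rV[R]_n -> R) (beta q : R) : Prop := KernelSolution {
  ks_beta1 : 1 < beta ;
  ks_betaq : beta < q ;
  ks_mg : measurable_fun setT g ;
  ks_g_ge0 : forall x, (0 <= g x)%E ;
  ks_g_le : forall x y, dot x x <= dot y y -> (g y <= g x)%E ;
  ks_g_lt : forall x y, dot x x < dot y y -> (g x < +oo)%E -> (g y < g x)%E ;
  ks_mu : measurable_fun setT u ;
  ks_u_gt0 : forall x, 0 < u x ;
  ks_uE : forall x,
    (u x)%:E = (\int[lebesgue_rV n]_y (g (x - y)%R * (u y `^ beta)%:E))%E ;
  ks_uq : (\int[lebesgue_rV n]_y (u y `^ q)%:E < +oo)%E ;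
  ks_small : forall eps : R, 0 < eps -> exists2 eta : R, 0 < eta &
    forall A : set 'rV[R]_n, measurable A ->
      (\int[lebesgue_rV n]_(y in A) (u y `^ q)%:E <= eta%:E)%E ->
      forall x, (\int[lebesgue_rV n]_(y in A)
        (g (x - y)%R * (u y `^ (beta - 1))%:E) <= eps%:E)%E ;
  ks_lsc : forall (x e : 'rV[R]_n) (t : R^nat) (c : R), t @ \oo --> (0 : R) ->
    c < u x -> \forall k \near \oo, c < u (x + t k *: e) }.

(** * The equation folded along one plane *)

Section kernel_solution_facts.
Context (R : realType) n (g : 'rV[R]_n -> \bar R) (u : 'rV[R]_n -> R) (beta q : R).
Hypothesis H : kernel_solution g u beta q.
Local Open Scope ereal_scope.
Local Notation mu := (@lebesgue_rV R n).
Implicit Types (x y : 'rV[R]_n).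

Lemma ks_g_eq x y : dot x x = dot y y -> g x = g y.
Proof. by move=> xy; apply/eqP; rewrite eq_le !(ks_g_le H)// xy. Qed.

Lemma ks_g_sym x y : g (x - y)%R = g (y - x)%R.
Proof. by apply: ks_g_eq; rewrite -opprB dotNl dotNr opprK. Qed.

Lemma measurable_ks_gl x : measurable_fun setT (fun y => g (x - y)%R).
Proof. by apply: measurableT_comp (ks_mg H) _; exact: measurable_subrV. Qed.

Lemma measurable_ks_gD : measurable_fun setT
  (fun z : 'rV[R]_n * 'rV[R]_n => g (z.1 - z.2)%R).
Proof. by apply: measurableT_comp (ks_mg H) _; exact: measurable_subrV. Qed.

Lemma measurable_ks_pow p : measurable_fun setT (fun y => u y `^ p)%R.
Proof. exact: (measurableT_comp (measurable_powR p) (ks_mu H)). Qed.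

Lemma ks_pow_gt0 p y : (0 < u y `^ p)%R.
Proof. by rewrite powR_gt0// (ks_u_gt0 H). Qed.

Lemma ks_pow_ge0 p y : (0 <= (u y `^ p)%:E).
Proof. by rewrite lee_fin powR_ge0. Qed.

Section one_plane.
Variables (e : 'rV[R]_n) (l : R).
Hypothesis e1 : dot e e = 1%R.
Local Notation r := (reflection e l).
Local Notation S := (halfspace e l).

Lemma measurable_ks_reflection : measurable_fun setT (fun y => u (r y)).
Proof. by apply: measurableT_comp (ks_mu H) _; exact: measurable_reflection. Qed.

Lemma ks_split x : (u x)%:E = \int[mu]_(y in S)
  (g (x - y)%R * (u y `^ beta)%:E + g (r x - y)%R * (u (r y) `^ beta)%:E).
Proof.
rewrite (ks_uE H) (ge0_integral_halfspace l e1
  (f := fun y => g (x - y)%R * (u y `^ beta)%:E)).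
- apply: eq_integral => y _; congr (_ + _ * _); apply: ks_g_eq.
  by rewrite dist_reflectionr.
- apply: emeasurable_funM; first exact: measurable_ks_gl.
  by apply/measurable_EFinP; exact: measurable_ks_pow.
- by move=> y; rewrite mule_ge0 ?ks_pow_ge0// (ks_g_ge0 H).
Qed.

Lemma ks_split_reflection x : (u (r x))%:E = \int[mu]_(y in S)
  (g (r x - y)%R * (u y `^ beta)%:E + g (x - y)%R * (u (r y) `^ beta)%:E).
Proof. by rewrite ks_split reflectionK. Qed.

Lemma ks_halfspace_le x y : S x -> S y -> g (r x - y)%R <= g (x - y)%R.
Proof.
rewrite /halfspace /= => xl yl; apply: (ks_g_le H).
by rewrite dist_reflection// lerDl !mulr_ge0// subr_ge0 ltW.
Qed.

Lemma ks_halfspace_lt x y : S x -> S y -> g (x - y)%R < +oo ->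
  g (r x - y)%R < g (x - y)%R.
Proof.
rewrite /halfspace /= => xl yl; apply: (ks_g_lt H).
by rewrite dist_reflection// ltrDl !mulr_gt0// subr_gt0.
Qed.

Lemma measurable_ks_term (A : set 'rV[R]_n) (x : 'rV[R]_n) (f : 'rV[R]_n -> R) :
  measurable_fun setT f -> measurable_fun A (fun y => g (x - y)%R * (f y)%:E).
Proof.
move=> mf; apply: measurable_funTS; apply: emeasurable_funM.
  exact: measurable_ks_gl.
exact/measurable_EFinP.
Qed.

Lemma measurable_ks_powr p : measurable_fun setT (fun y => u (r y) `^ p)%R.
Proof. exact: (measurableT_comp (measurable_powR p) measurable_ks_reflection). Qed.

(** Both folded integrals run over the same half-space, so the integrands are compared by
    [rearrangement_le] with [a = g (x - y)] and [a' = g (r x - y)]. The term in [b] is the price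
    paid at those y where [u y] exceeds [u (r y)]. *)
Lemma ks_reflection_le x : S x ->
  (u x)%:E <= (u (r x))%:E +
    \int[mu]_(y in S) (g (x - y)%R *
      (Num.max (u y `^ beta - u (r y) `^ beta) 0)%:E).
Proof.
move=> Sx; rewrite ks_split ks_split_reflection.
have mS := measurable_halfspace e l.
have m1 := measurable_ks_term (A := S) x (measurable_ks_pow beta).
have m2 := measurable_ks_term (A := S) x (measurable_ks_powr beta).
have m3 := measurable_ks_term (A := S) (r x) (measurable_ks_pow beta).
have m4 := measurable_ks_term (A := S) (r x) (measurable_ks_powr beta).
have m5 : measurable_fun S (fun y => g (x - y)%R *
      (Num.max (u y `^ beta - u (r y) `^ beta) 0)%:E).
  apply: measurable_ks_term; apply: measurable_maxr => //.
  by apply: measurable_funB; [exact: measurable_ks_pow|exact: measurable_ks_powr].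
rewrite -ge0_integralD => [|//|y Sy||y Sy|//]; last 3 first.
- by rewrite adde_ge0// mule_ge0 ?(ks_g_ge0 H)// lee_fin powR_ge0.
- exact: emeasurable_funD.
- by rewrite mule_ge0 ?(ks_g_ge0 H)// lee_fin le_max lexx orbT.
apply: ge0_le_integral => [//|y Sy|||y Sy].
- by rewrite adde_ge0// mule_ge0 ?(ks_g_ge0 H)// lee_fin powR_ge0.
- exact: emeasurable_funD.
- by apply: emeasurable_funD => //; exact: emeasurable_funD.
- apply: rearrangement_le.
  + exact: (ks_g_ge0 H).
  + exact: ks_halfspace_le.
  + exact: ks_pow_gt0.
  + exact: ks_pow_gt0.
  + by rewrite le_max lexx orbT.
  + by rewrite le_max lexx.
Qed.

End one_plane.
End kernel_solution_facts.

(* A truncation [phi = (w - c)^+] inherits [phi <= \int k v phi] because the kernel has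
   mass at most 1/2 on A; integrating against v and using the symmetry of k, the
   finite number [\int v phi] is at most its own half. *)
Lemma negligible_small_kernel d (T : measurableType d) (R : realType)
    (mu : {sigma_finite_measure set T -> \bar R}) (k : T * T -> \bar R)
    (v w : T -> R) (A : set T) :
  measurable_fun setT k -> (forall z, (0 <= k z)%E) ->
  (forall x y, k (x, y) = k (y, x)) ->
  measurable_fun setT v -> (forall x, 0 < v x) ->
  measurable_fun setT w -> (forall x, 0 <= w x) ->
  measurable A -> (forall x, ~ A x -> w x = 0) ->
  (forall x, ((w x)%:E <= \int[mu]_y (k (x, y) * (v y * w y)%:E))%E) ->
  (forall x, (\int[mu]_(y in A) (k (x, y) * (v y)%:E) <= (2^-1)%:E)%E) ->
  (forall c, 0 < c -> (\int[mu]_x (v x * Num.max (w x - c) 0)%:E < +oo)%E) ->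
  mu.-negligible [set x | 0 < w x].
Proof.
move=> mk k0 ksym mv v0 mw w0 mA wA wk kA fin.
suff null c : 0 < c -> mu.-negligible [set x | c < w x].
  apply: (negligibleS _ (negligible_bigcup (fun k => null k.+1%:R^-1 _))) => [x /= wx|i].
    have [i _ Hi] := near_infty_natSinv_lt (PosNum wx).
    by exists i => //; exact: (Hi i (leqnn i)).
  by rewrite invr_gt0.
move=> c0; have c0E : (0 <= c%:E)%E by rewrite lee_fin ltW.
pose phi x := Num.max (w x - c) 0.
have {fin} : (\int[mu]_x (v x * phi x)%:E < +oo)%E by exact: fin.
have mphi : measurable_fun setT phi.
  by apply: measurable_maxr => //; exact: measurable_funB.
have mvphi : measurable_fun setT (fun x => (v x * phi x)%:E).
  by apply/measurable_EFinP; exact: measurable_funM.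
have phi0 x : 0 <= phi x by rewrite le_max lexx orbT.
have vphi0 x : (0 <= (v x * phi x)%:E)%E by rewrite lee_fin mulr_ge0// ltW.
have phiA x : ~ A x -> phi x = 0.
  by move=> nAx; rewrite /phi wA// sub0r; apply/max_idPr; rewrite oppr_le0 ltW.
(* Cutting [v] off outside [A] turns the mass bound over [A] into one over the whole space; [phi]
   vanishes outside [A], so nothing is lost. *)
pose vA x := v x * \1_A x.
have vA0 x : 0 <= vA x by rewrite mulr_ge0// ltW.
have mvA : measurable_fun setT vA by apply: measurable_funM => //; exact: measurable_indic.
have kAE x : (\int[mu]_y (k (x, y) * (vA y)%:E) <= (2^-1)%:E)%E.
  apply: le_trans (kA x); rewrite [leRHS]integral_mkcond.
  suff -> : (fun y => k (x, y) * (vA y)%:E)%E = (fun y => k (x, y) * (v y)%:E)%E \_ A by [].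
  apply/funext => y; rewrite patchE /vA indicE.
  by case: ifPn => _; rewrite ?mulr1 ?mulr0 ?mule0.
have mkx x : measurable_fun setT (fun y => k (x, y)) by exact: measurableT_comp.
have mkvA x : measurable_fun setT (fun y => k (x, y) * (vA y)%:E)%E.
  by apply: emeasurable_funM => //; exact/measurable_EFinP.
have mkphi x : measurable_fun setT (fun y => k (x, y) * (v y * phi y)%:E)%E.
  exact: emeasurable_funM.
have mkw x : measurable_fun setT (fun y => k (x, y) * (v y * w y)%:E)%E.
  by apply: emeasurable_funM => //; apply/measurable_EFinP; exact: measurable_funM.
pose J x := (\int[mu]_y (k (x, y) * (v y * phi y)%:E))%E.
have kphi0 x y : (0 <= k (x, y) * (v y * phi y)%:E)%E by exact: mule_ge0.
have kvA0 x y : (0 <= k (x, y) * (vA y)%:E)%E by apply: mule_ge0; rewrite ?lee_fin.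
have J0 x : (0 <= J x)%E by apply: integral_ge0 => y _; exact: kphi0.
(* On [A] one has [w <= phi + c], and the constant c contributes at most c / 2 because the kernel
   has mass at most 1/2. Subtracting c then leaves [phi <= J]. *)
have wJ x : ((w x)%:E <= J x + (c / 2)%:E)%E.
  apply: (le_trans (wk x)).
  apply: (@le_trans _ _ (\int[mu]_y (k (x, y) * (v y * phi y)%:E + c%:E * (k (x, y) * (vA y)%:E)))%E).
    apply: ge0_le_integral => [//|y _|//||y _].
    - by apply: mule_ge0; [exact: k0|rewrite lee_fin; apply: mulr_ge0; [exact: ltW|exact: w0]].
    - apply: emeasurable_funD => //; apply: emeasurable_funM => //.
    - rewrite [(c%:E * _)%E]muleCA -EFinM -ge0_muleDr ?lee_fin; last 2 first.
      + by apply: mulr_ge0; [exact: ltW|exact: phi0].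
      + by apply: mulr_ge0; [exact: ltW|exact: vA0].
      apply: lee_wpmul2l; first exact: k0.
      rewrite -EFinD lee_fin.
      have [Ay|nAy] := pselect (A y); last first.
        by rewrite wA// mulr0 addr_ge0//; apply: mulr_ge0; rewrite ?phi0 ?vA0// ltW.
      rewrite /vA indicE mem_set// mulr1 [c * _]mulrC -mulrDr ler_pM2l//.
      by rewrite -lerBlDr /phi le_max lexx.
  rewrite ge0_integralD//; last 2 first.
  - by move=> y _; apply: mule_ge0; [exact: c0E|exact: kvA0].
  - exact: emeasurable_funM.
  rewrite leeD2l// ge0_integralZl//.
  by rewrite EFinM; apply: lee_wpmul2l; [exact: c0E|exact: kAE].
have phiJ x : ((phi x)%:E <= J x)%E.
  rewrite /phi; have [h|h] := leP (w x - c) 0; first exact: J0.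
  rewrite EFinB leeBlDr//; apply: (le_trans (wJ x)); apply: leeD2l.
  by rewrite lee_fin; lra.
set I := (\int[mu]_x (v x * phi x)%:E)%E => Ioo.
have I0 : (0 <= I)%E by apply: integral_ge0 => x _; exact: vphi0.
pose F z := ((vA z.1)%:E * (k z * (v z.2 * phi z.2)%:E))%E.
have F0 z : (0 <= F z)%E.
  by case: z => x y; apply: mule_ge0; [rewrite lee_fin; exact: vA0|exact: kphi0].
have mF : measurable_fun setT F.
  apply: emeasurable_funM.
    by apply/measurable_EFinP; exact: measurableT_comp.
  apply: emeasurable_funM => //.
  exact: (measurableT_comp mvphi).
have I1 : (I <= \int[mu]_x \int[mu]_y F (x, y))%E.
  apply: ge0_le_integral => [//|x _|//||x _]; first exact: vphi0.
    exact: (measurable_fun_fubini_tonelli_F F mF F0).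
  rewrite /F /= ge0_integralZl//; last by rewrite lee_fin; exact: vA0.
  have [Ax|nAx] := pselect (A x); last first.
    by rewrite phiA// mulr0; apply: mule_ge0; [rewrite lee_fin; exact: vA0|exact: J0].
  rewrite /vA indicE mem_set// mulr1 EFinM; apply: lee_wpmul2l; last exact: phiJ.
  by rewrite lee_fin ltW.
have I2 : (\int[mu]_y \int[mu]_x F (x, y) <= I * (2^-1)%:E)%E.
  rewrite -(ge0_integralZr mu measurableT mvphi (fun x _ => vphi0 x)); last first.
    by rewrite lee_fin.
  apply: ge0_le_integral => [//|y _|||y _].
  - by apply: integral_ge0 => x _; exact: F0.
  - exact: (measurable_fun_fubini_tonelli_G F mF F0).
  - by apply: emeasurable_funM.
  - have -> : (\int[mu]_x F (x, y) = (v y * phi y)%:E * \int[mu]_x (k (y, x) * (vA x)%:E))%E.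
      rewrite -(ge0_integralZl mu measurableT (mkvA y) (fun x _ => kvA0 y x) (vphi0 y)).
      apply: eq_integral => x _; rewrite /F /= (ksym y x).
      by rewrite [LHS]muleC [X in (X * _)%E = _]muleC -muleA.
    by apply: lee_wpmul2l; [exact: vphi0|exact: kAE].
have : (I <= I * (2^-1)%:E)%E.
  apply: (le_trans I1); rewrite fubini_tonelli//.
have Ifin : I \is a fin_num by rewrite ge0_fin_numE.
rewrite -(fineK Ifin) -EFinM lee_fin => Ile.
have IE : I = 0%E.
  rewrite -(fineK Ifin); congr EFin; apply/eqP; rewrite eq_le; apply/andP; split.
    by move: Ile; lra.
  exact: fine_ge0.
apply: (negligibleS _ (negligible_integral_eq0 measurableT mvphi (fun x _ => vphi0 x) IE)).
move=> x /= cw; split => // -[] /eqP; rewrite mulf_eq0 gt_eqF//= /phi => /eqP h.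
have : 0 < Num.max (w x - c) 0 by rewrite lt_max subr_gt0 cw.
by rewrite h ltxx.
Qed.

(** * The excess of u over its reflection *)

Section excess.
Context (R : realType) n (g : 'rV[R]_n -> \bar R) (u : 'rV[R]_n -> R) (beta q : R).
Hypothesis H : kernel_solution g u beta q.
Variables (e : 'rV[R]_n) (l : R).
Hypothesis e1 : dot e e = 1%R.
Local Open Scope ereal_scope.
Local Notation mu := (@lebesgue_rV R n).
Local Notation r := (reflection e l).
Local Notation S := (halfspace e l).
Implicit Types (x y : 'rV[R]_n).

Definition excess_set := [set y | S y /\ (u (r y) < u y)%R].

Definition excess y : R := ((u y - u (r y)) * \1_excess_set y)%R.

Lemma measurable_excess_set : measurable excess_set.
Proof.
have mS := measurable_halfspace e l.
have /(_ measurableT [set true]) := measurable_fun_ltr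
  (measurable_ks_reflection H e l) (ks_mu H).
rewrite setTI => /(_ I) mlt.
have -> : excess_set = S `&` (fun x => u (r x) < u x)%R @^-1` [set true].
  by apply/seteqP; split => x /= [? ?].
exact: measurableI.
Qed.

Lemma measurable_excess : measurable_fun setT excess.
Proof.
apply: measurable_funM.
  by apply: measurable_funB; [exact: ks_mu H|exact: measurable_ks_reflection H _ _].
by apply: measurable_indic; exact: measurable_excess_set.
Qed.

Lemma excessE y : excess_set y -> excess y = (u y - u (r y))%R.
Proof. by move=> ey; rewrite /excess indicE mem_set// mulr1. Qed.

Lemma excess_eq0 y : ~ excess_set y -> excess y = 0%R.
Proof. by move=> ey; rewrite /excess indicE memNset// mulr0. Qed.

Lemma excess_ge0 y : (0 <= excess y)%R.
Proof.
have [ey|ey] := pselect (excess_set y); last by rewrite excess_eq0.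
by rewrite excessE// subr_ge0 ltW//; case: ey.
Qed.

Lemma excess_gt0 y : excess_set y -> (0 < excess y)%R.
Proof. by move=> ey; rewrite excessE// subr_gt0; case: ey. Qed.

Lemma excess_le y : (excess y <= u y)%R.
Proof.
have uy := ks_u_gt0 H y; have ur := ks_u_gt0 H (r y).
have [ey|ey] := pselect (excess_set y); last by rewrite excess_eq0 ?ltW.
by rewrite excessE//; lra.
Qed.

Variable N : nat.
Hypothesis bN : (beta <= N%:R)%R.

(** The factor [N] is the constant of [powRB_le], which replaces the difference of the powers [beta]
    by u^(beta-1) times the excess. *)
Definition linear_kernel (z : 'rV[R]_n * 'rV[R]_n) := N%:R%:E * g (z.1 - z.2)%R.

Lemma linear_kernel_ge0 z : 0 <= linear_kernel z.
Proof. by rewrite mule_ge0 ?(ks_g_ge0 H)// lee_fin ler0n. Qed.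

Lemma measurable_linear_kernel : measurable_fun setT linear_kernel.
Proof. by apply: emeasurable_funM => //; exact: measurable_ks_gD H. Qed.

Lemma excess_integrand_ge0 x y : 0 <= linear_kernel (x, y) * (u y `^ (beta - 1) * excess y)%:E.
Proof.
apply: mule_ge0; first exact: linear_kernel_ge0.
by rewrite lee_fin mulr_ge0 ?powR_ge0// excess_ge0.
Qed.

Lemma measurable_excess_integrand x : measurable_fun setT
  (fun y => linear_kernel (x, y) * (u y `^ (beta - 1) * excess y)%:E).
Proof.
apply: emeasurable_funM.
  by apply: measurableT_comp measurable_linear_kernel _.
apply/measurable_EFinP; apply: measurable_funM; last exact: measurable_excess.
exact: measurable_ks_pow H _.
Qed.

Lemma ks_le_excess x : S x -> (u x)%:E <= (u (r x))%:E +
  \int[mu]_y (linear_kernel (x, y) * (u y `^ (beta - 1) * excess y)%:E).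
Proof.
move=> Sx; apply: (le_trans (ks_reflection_le H e1 Sx)).
have mS := measurable_halfspace e l.
rewrite leeD2l// integral_mkcond; apply: ge0_le_integral => [//|y _||//|y _].
- apply: erestrict_ge0 => z _; apply: mule_ge0; first exact: ks_g_ge0 H _.
  by rewrite lee_fin le_max lexx orbT.
- apply/(measurable_restrictT _ mS); apply: (measurable_ks_term H).
  apply: measurable_maxr => //; apply: measurable_funB.
    exact: measurable_ks_pow H _.
  exact: measurable_ks_powr H _ _ _.
- exact: measurable_excess_integrand.
- have pos : (0 <= N%:R * (u y `^ (beta - 1) * excess y))%R.
    by apply: mulr_ge0 => //; apply: mulr_ge0; [exact: powR_ge0|exact: excess_ge0].
  rewrite patchE; case: ifPn => [/set_mem Sy|_]; last exact: excess_integrand_ge0.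
  rewrite /linear_kernel /= -muleA muleCA; apply: lee_wpmul2l; first exact: ks_g_ge0 H _.
  rewrite -EFinM lee_fin ge_max; apply/andP; split; last exact: pos.
  have [yr|yr] := ltP (u (r y)) (u y).
    by rewrite excessE//; apply: powRB_le => //; [exact: ks_u_gt0 H _|exact: ltW].
  apply: le_trans pos; rewrite subr_le0; apply: ge0_ler_powR => //.
  - by apply/ltW/(lt_trans _ (ks_beta1 H)).
  - by rewrite nnegrE ltW// (ks_u_gt0 H).
  - by rewrite nnegrE ltW// (ks_u_gt0 H).
Qed.

Lemma excess_le_integral x : (excess x)%:E <=
  \int[mu]_y (linear_kernel (x, y) * (u y `^ (beta - 1) * excess y)%:E).
Proof.
have [ex|ex] := pselect (excess_set x); last first.
  by rewrite excess_eq0//; apply: integral_ge0 => y _; exact: excess_integrand_ge0.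
rewrite excessE// EFinB leeBlDl//; apply: ks_le_excess; by case: ex.
Qed.

(** Where the truncation is positive, u is at least c, so the integrand is at most u^beta =
    u^(beta-q) u^q <= c^(beta-q) u^q, as beta < q. *)
Lemma excess_truncation_integral (c : R) : (0 < c)%R ->
  \int[mu]_x (u x `^ (beta - 1) * Num.max (excess x - c) 0)%:E < +oo.
Proof.
move=> c0; have bq := ks_betaq H.
have cq : (0 <= c `^ (beta - q))%R by exact: powR_ge0.
apply: (@le_lt_trans _ _ (\int[mu]_x ((c `^ (beta - q))%:E * (u x `^ q)%:E))).
  apply: ge0_le_integral => [//|x _|||x _].
  - by rewrite lee_fin mulr_ge0 ?powR_ge0// le_max lexx orbT.
  - apply/measurable_EFinP; apply: measurable_funM; first exact: measurable_ks_pow H _.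
    apply: measurable_maxr => //; apply: measurable_funB => //.
    exact: measurable_excess.
  - apply/measurable_EFinP; apply: measurable_funM => //.
    exact: measurable_ks_pow H _.
  - rewrite -EFinM lee_fin.
    have [h|h] := leP (excess x - c)%R 0%R; first by rewrite mulr0 mulr_ge0// powR_ge0.
    have ux := ks_u_gt0 H x; have exu := excess_le x.
    have cu : (c <= u x)%R by lra.
    apply: (@le_trans _ _ (u x `^ (beta - 1) * u x)%R).
      by apply: ler_wpM2l; [exact: powR_ge0|lra].
    have -> : (u x `^ (beta - 1) * u x = u x `^ (beta - q) * u x `^ q)%R.
      rewrite -[X in (_ * X)%R](powRr1 (ltW ux)) -!powRD ?subrK// (gt_eqF ux);
      by rewrite implybT.
    apply: ler_wpM2r; first exact: powR_ge0.
    rewrite -opprB !powRN lef_pV2 ?posrE ?powR_gt0//.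
    by apply: ge0_ler_powR; rewrite ?nnegrE ?subr_ge0 // ltW.
rewrite ge0_integralZl//; last 2 first.
- by apply/measurable_EFinP; exact: measurable_ks_pow H _.
- by move=> x _; rewrite lee_fin powR_ge0.
by rewrite lte_mul_pinfty// (ks_uq H).
Qed.

Lemma excess_set_negligible :
  (forall x, \int[mu]_(y in excess_set)
    (linear_kernel (x, y) * (u y `^ (beta - 1))%:E) <= (2^-1)%:E) ->
  mu.-negligible excess_set.
Proof.
move=> small.
have sub : excess_set `<=` [set x | (0 < excess x)%R] by move=> x; exact: excess_gt0.
apply: (negligibleS sub).
apply: (@negligible_small_kernel _ _ _ mu linear_kernel
  (fun x => u x `^ (beta - 1))%R excess excess_set).
- exact: measurable_linear_kernel.
- exact: linear_kernel_ge0.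
- by move=> x y; rewrite /linear_kernel /= (ks_g_sym H).
- exact: measurable_ks_pow H _.
- by move=> x; exact: ks_pow_gt0 H _ _.
- exact: measurable_excess.
- exact: excess_ge0.
- exact: measurable_excess_set.
- exact: excess_eq0.
- exact: excess_le_integral.
- exact: small.
- exact: excess_truncation_integral.
Qed.

(** The integral in [ks_le_excess] does not see a null set, so a comparison almost everywhere
    becomes one at every point of the half-space. *)
Lemma excess_negligible_le : mu.-negligible excess_set ->
  forall x, S x -> (u x <= u (r x))%R.
Proof.
move=> nul x Sx; have := ks_le_excess Sx.
rewrite (ae_eq_integral (cst 0))//.
- by rewrite integral0 adde0 lee_fin.
- exact: measurable_excess_integrand.
- apply: negligibleS nul => y /= h; apply: contrapT => ey; apply: h => _.
  by rewrite excess_eq0// mulr0 mule0.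
Qed.

End excess.

(** * Starting and moving the plane *)

Section moving_planes.
Context (R : realType) n (g : 'rV[R]_n -> \bar R) (u : 'rV[R]_n -> R) (beta q : R).
Hypothesis H : kernel_solution g u beta q.
Local Notation mu := (@lebesgue_rV R n).
Implicit Types (x y z e : 'rV[R]_n) (l : R).

Definition plane_le e l := forall x, halfspace e l x -> u x <= u (reflection e l x).

(** [ks_small] bounds the kernel for all sets and centres at once, so one [eta] serves every
    direction and level. What remains each time is to make the integral of u^q over the excess set
    small. *)
Lemma plane_le_threshold : exists2 eta : R, 0 < eta &
  forall e l, dot e e = 1 ->
    (\int[mu]_(y in excess_set u e l) (u y `^ q)%:E <= eta%:E)%E -> plane_le e l.
Proof.
have b1 := ks_beta1 H; pose N := Num.Def.archi_bound beta.
have bN : beta < N%:R by apply: archi_boundP; lra.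
have N0 : 0 < N%:R :> R by lra.
(* Multiplied by the factor [N] of [linear_kernel], this gives the mass 1/2. *)
have eps0 : 0 < (2 * N%:R)^-1 :> R by rewrite invr_gt0 mulr_gt0.
have [eta eta0 small] := ks_small H eps0.
exists eta => // e l e1 ex.
apply: (excess_negligible_le H e1 (ltW bN)).
apply: (excess_set_negligible H e1 (ltW bN)) => x.
have mE := measurable_excess_set H e l.
have E0 : (\int[mu]_(y in excess_set u e l) (linear_kernel g N (x, y) * (u y `^ (beta - 1))%:E) =
   N%:R%:E * \int[mu]_(y in excess_set u e l) (g (x - y)%R * (u y `^ (beta - 1))%:E))%E.
  rewrite -ge0_integralZl//.
  - by apply: eq_integral => y _; rewrite /linear_kernel /= muleA.
  - by apply: (measurable_ks_term H); exact: measurable_ks_pow H _.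
  - by move=> y _; apply: mule_ge0; [exact: ks_g_ge0 H _|exact: ks_pow_ge0].
rewrite E0; apply: (@le_trans _ _ (N%:R%:E * ((2 * N%:R)^-1)%:E)%E).
  by apply: lee_wpmul2l; [rewrite lee_fin ltW|exact: small].
rewrite -EFinM lee_fin le_eqVlt; apply/orP; left; apply/eqP; field.
by rewrite gt_eqF.
Qed.

Lemma ks_vanishing_sets (E : (set 'rV[R]_n)^nat) (eta : R) :
  (forall k, measurable (E k)) ->
  {ae mu, forall x, \forall k \near \oo, ~ E k x} -> 0 < eta ->
  exists k, (\int[mu]_(y in E k) (u y `^ q)%:E <= eta%:E)%E.
Proof.
apply: integral_vanishing_sets.
- by apply/measurable_EFinP; exact: measurable_ks_pow H _.
- by move=> x; exact: ks_pow_ge0.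
- exact: ks_uq H.
Qed.

Lemma ks_subset_integral (A B : set 'rV[R]_n) : measurable A -> measurable B ->
  A `<=` B -> (\int[mu]_(y in A) (u y `^ q)%:E <= \int[mu]_(y in B) (u y `^ q)%:E)%E.
Proof.
move=> mA mB AB; apply: ge0_subset_integral => //.
- by apply: measurable_funTS; apply/measurable_EFinP; exact: measurable_ks_pow H _.
- by move=> x _; exact: ks_pow_ge0.
Qed.

Lemma plane_le_start e : dot e e = 1 -> exists l0, forall l, l <= l0 -> plane_le e l.
Proof.
move=> e1; have [eta eta0 thr] := plane_le_threshold.
have [k Ek] : exists k : nat,
    (\int[mu]_(y in halfspace e (- k%:R)) (u y `^ q)%:E <= eta%:E)%E.
  apply: ks_vanishing_sets => [k||//]; first exact: measurable_halfspace.
  apply: aeW => x; exists (Num.Def.archi_bound `|dot x e|) => // k /= Kk.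
  apply/negP; rewrite -leNgt.
  have := archi_boundP (normr_ge0 (dot x e)).
  have : (Num.Def.archi_bound `|dot x e|)%:R <= k%:R :> R by rewrite ler_nat.
  have := ler_norm (- dot x e); rewrite normrN.
  set K := (Num.Def.archi_bound _)%:R; lra.
exists (- k%:R) => l lk; apply: thr => //; apply: le_trans Ek.
apply: ks_subset_integral.
- exact: measurable_excess_set H _ _.
- exact: measurable_halfspace.
- by move=> x [+ _]; rewrite /halfspace /= => xl; exact: lt_le_trans lk.
Qed.

(** Suppose the inequality fails at x, and keep its mirror image [reflection e l x] fixed.
    Reflecting that image in a plane at level [l - s] gives [x - (2 * s) *: e], which lies below
    this plane and so has a value at most that of the image. As s tends to 0 this contradicts lower
    semicontinuity at x. *)
Lemma plane_le_closed e l : dot e e = 1 ->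
  (forall l', l' < l -> plane_le e l') -> plane_le e l.
Proof.
move=> e1 Pl x Sx; rewrite leNgt; apply/negP => ux.
pose t k : R := - 2 * k.+1%:R^-1.
have t0 : t @ \oo --> (0 : R).
  by rewrite -(mulr0 (- 2)); apply: cvgM; [exact: cvg_cst|exact: cvg_harmonic].
have [k _ Hk] := ks_lsc H e t0 ux.
have := Hk k (leqnn k) => /=; apply/negP; rewrite -leNgt.
have [s s0 sE] : exists2 s : R, 0 < s & s = k.+1%:R^-1.
  by exists k.+1%:R^-1 => //; rewrite invr_gt0.
pose l' := l - s.
have dx := dot_reflection l e1 x.
have xE : x + t k *: e = reflection e l' (reflection e l x).
  rewrite {1}/reflection dx /reflection -addrA -opprD -scalerDl -scaleNr.
  by congr (_ + _ *: _); rewrite /t -sE /l'; ring.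
rewrite xE -{2}(reflectionK l' e1 (reflection e l x)).
apply: Pl; first by rewrite /l'; lra.
by move: Sx; rewrite /halfspace /= (dot_reflection l' e1) dx /l' => Sx; lra.
Qed.

(** Otherwise there are bad levels [L k] decreasing towards l. Each x off the plane at level l
    eventually leaves their excess sets: above that plane, because x is no longer in the half-space;
    below it, because the reflected point tends to [reflection e l x], where u is strictly larger
    and lower semicontinuous. Hence some excess set falls below the threshold. *)
Lemma plane_le_push e l : dot e e = 1 ->
  (forall x, halfspace e l x -> u x < u (reflection e l x)) ->
  exists2 d : R, 0 < d & forall l', l < l' -> l' < l + d -> plane_le e l'.
Proof.
move=> e1 lt; apply: contrapT => nex.
have {nex} bad k : exists l', [/\ l < l', l' < l + k.+1%:R^-1 & ~ plane_le e l'].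
  apply: contrapT => nk; apply: nex; exists k.+1%:R^-1 => [|l' ll' l'k].
    by rewrite invr_gt0.
  by apply: contrapT => nP; apply: nk; exists l'.
have {bad} [L HL] := choice bad.
have [eta eta0 thr] := plane_le_threshold.
have t0 : (fun k => 2 * (L k - l)) @ \oo --> (0 : R).
  apply/cvgr0Pnorm_lt => eps eps0; near=> k.
  have [l1 l2 _] := HL k; rewrite ger0_norm; last by lra.
  have : k.+1%:R^-1 < eps / 2.
    by near: k; exact: near_infty_natSinv_lt (PosNum (divr_gt0 eps0 (ltr0Sn _ 1))).
  by move: l1 l2; move: (k.+1%:R^-1 : R) => s *; lra.
have [k Ek] : exists k : nat,
    (\int[mu]_(y in excess_set u e (L k)) (u y `^ q)%:E <= eta%:E)%E.
  apply: ks_vanishing_sets => [k||//]; first exact: measurable_excess_set H _ _.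
  exists [set x | dot x e = l]; split.
  - by have := measurable_dotl e measurableT (measurable_set1 l); rewrite setTI.
  - exact: lebesgue_rV_hyperplane.
  move=> x /= h; apply: contrapT => xl; apply: h.
  have [xl'|lx] := ltP (dot x e) l.
    have := ks_lsc H e t0 (lt x xl'); apply: filterS => k ux [_].
    have -> : reflection e (L k) x = reflection e l x + (2 * (L k - l)) *: e.
      rewrite /reflection.
      have -> : 2 * (dot x e - L k) = 2 * (dot x e - l) - 2 * (L k - l) by ring.
      by rewrite scalerBl opprD opprK addrA.
    by apply/negP; rewrite -leNgt ltW.
  have {}lx : l < dot x e by rewrite lt_neqAle lx andbT eq_sym; apply/eqP.
  have lx0 : 0 < dot x e - l by rewrite subr_gt0.
  have := near_infty_natSinv_lt (PosNum lx0).
  apply: filterS => k /= kx [Sx _]; move: Sx; rewrite /halfspace /=.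
  have [l1 l2 _] := HL k; apply/negP; rewrite -leNgt.
  by move: l1 l2 kx; move: (k.+1%:R^-1 : R) => s *; lra.
have [_ _] := HL k; apply; exact: thr.
Unshelve. all: by end_near.
Qed.

End moving_planes.

(** * The critical plane in a given direction *)

Section symmetry.
Context (R : realType) n (g : 'rV[R]_n -> \bar R) (u : 'rV[R]_n -> R) (beta q : R).
Hypothesis H : kernel_solution g u beta q.
Local Notation mu := (@lebesgue_rV R n).
Implicit Types (x y z e : 'rV[R]_n) (l : R).

(** A strong maximum principle. If u and its reflection agree at one x of the half-space, the
    difference of the two folded integrands at x is nonnegative with integral 0. It is the product
    of a positive kernel difference and the difference of the powers, so the latter vanishes almost
    everywhere. *)
Lemma plane_symmetric e l : dot e e = 1 -> plane_le u e l ->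
  (exists2 x, halfspace e l x & u (reflection e l x) <= u x) ->
  forall z, u (reflection e l z) = u z.
Proof.
move=> e1 P [x Sx ux]; pose r := reflection e l; pose S := halfspace e l.
have mS : measurable S := measurable_halfspace e l.
have urx : u (r x) = u x by apply/eqP; rewrite eq_le ux P.
have [mp mpr] := (measurable_ks_pow H beta, measurable_ks_powr H e l beta).
pose F1 y := (g (x - y)%R * (u y `^ beta)%:E + g (r x - y)%R * (u (r y) `^ beta)%:E)%E.
pose F2 y := (g (r x - y)%R * (u y `^ beta)%:E + g (x - y)%R * (u (r y) `^ beta)%:E)%E.
have mF1 : measurable_fun S F1 by apply: emeasurable_funD; apply: (measurable_ks_term H).
have mF2 : measurable_fun S F2 by apply: emeasurable_funD; apply: (measurable_ks_term H).
have term_ge0 z y p : (0 <= g (z - y)%R * (p `^ beta)%:E)%E.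
  by apply: mule_ge0; [exact: ks_g_ge0 H _|rewrite lee_fin powR_ge0].
have F1_ge0 y : (0 <= F1 y)%E by exact: adde_ge0.
have F2_ge0 y : (0 <= F2 y)%E by exact: adde_ge0.
have IF1 : (\int[mu]_(y in S) F1 y = (u x)%:E)%E by rewrite (ks_split H l e1).
have IF2 : (\int[mu]_(y in S) F2 y = (u x)%:E)%E.
  by rewrite -urx (ks_split_reflection H l e1).
(* Off [Z] the kernel values are finite and may be subtracted. [Z] is null because [F1] is
   integrable and infinite on it. *)
pose Z := S `&` [set y | g (x - y)%R = +oo%E].
have mZ : measurable Z.
  apply: measurableI => //.
  have := measurable_ks_gl H x measurableT (emeasurable_set1 (+oo%E : \bar R)).
  by rewrite setTI.
have iF1 : mu.-integrable S F1.
  apply/integrableP; split => //; rewrite (eq_integral F1) ?IF1 ?ltry// => y _.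
  by rewrite gee0_abs.
have Z0 : mu Z = 0%E.
  apply/(negligibleP _ mZ); have := integrable_ae mS iF1.
  apply: negligibleS => y [Sy gy] /(_ Sy); apply/negP.
  rewrite /F1 gy gt0_mulye ?lte_fin ?ks_pow_gt0//; last exact: (ks_pow_gt0 H).
  by rewrite addye// gt_eqF// (lt_le_trans _ (term_ge0 _ _ _))// ltNyr.
have mE : measurable (S `\` Z) by exact: measurableD.
have Efin y : (S `\` Z) y -> g (x - y)%R \is a fin_num /\ g (r x - y)%R \is a fin_num.
  move=> [Sy nZ]; have goo : (g (x - y)%R < +oo)%E.
    by rewrite lt_neqAle leey andbT; apply/eqP => gy; apply: nZ.
  split; rewrite ge0_fin_numE ?(ks_g_ge0 H)//.
  by apply: le_lt_trans goo; exact: (ks_halfspace_le H e1 Sx Sy).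
pose D y := ((fine (g (x - y)%R) - fine (g (r x - y)%R)) * (u (r y) `^ beta - u y `^ beta))%:E.
have F2E y : (S `\` Z) y -> F2 y = (F1 y + D y)%E.
  move=> /Efin[a b]; rewrite /F1 /F2 /D -(fineK a) -(fineK b) -!EFinM -!EFinD.
  by congr EFin => /=; ring.
have D_ge0 y : (S `\` Z) y -> (0 <= D y)%E.
  move=> Ey; have [a b] := Efin y Ey; have [Sy _] := Ey.
  rewrite lee_fin mulr_ge0// subr_ge0.
    by rewrite fine_le// (ks_halfspace_le H e1 Sx Sy).
  apply: ge0_ler_powR; rewrite ?nnegrE ?(ltW (ks_u_gt0 H _))//.
    by apply/ltW/(lt_trans _ (ks_beta1 H)).
  exact: P.
have mfine z : measurable_fun setT (fun y => fine (g (z - y)%R)).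
  by apply: measurableT_comp; [exact: fine_measurable|exact: measurable_ks_gl H _].
have mD : measurable_fun (S `\` Z) D.
  apply: measurable_funTS; apply/measurable_EFinP; apply: measurable_funM; exact: measurable_funB.
have ID : (\int[mu]_(y in S `\` Z) D y = 0)%E.
  have I1 := ge0_negligible_integral mZ mS mF1 (fun y _ => F1_ge0 y) Z0.
  have I2 := ge0_negligible_integral mZ mS mF2 (fun y _ => F2_ge0 y) Z0.
  have I3 : (\int[mu]_(y in S `\` Z) F2 y =
      \int[mu]_(y in S `\` Z) F1 y + \int[mu]_(y in S `\` Z) D y)%E.
    rewrite -ge0_integralD//; last exact: measurable_funS mF1.
    by apply: eq_integral => y /set_mem; exact: F2E.
  move: I3; rewrite -I1 -I2 IF1 IF2 => h.
  have : (\int[mu]_(y in S `\` Z) D y = (u x)%:E - (u x)%:E)%E.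
    by rewrite {1}h addeAC -EFinB subrr add0e.
  by rewrite -EFinB subrr.
have null := negligible_integral_eq0 mE mD D_ge0 ID.
have null' : mu.-negligible [set y | S y /\ u (r y) `^ beta <> u y `^ beta].
  have nZ : mu.-negligible Z by apply/(negligibleP _ mZ).
  apply: negligibleS (negligibleU nZ null) => y [Sy neq].
  have [Zy|nZy] := pselect (Z y); [by left|right; split => // -[] /eqP].
  have [a b] := Efin y (conj Sy nZy).
  rewrite mulf_eq0 => /orP[|]; rewrite subr_eq0 => /eqP // h.
  have goo : (g (x - y)%R < +oo)%E by move: a; rewrite ge0_fin_numE// (ks_g_ge0 H).
  have := ks_halfspace_lt H e1 Sx Sy goo.
  by rewrite -/r -(fineK a) -(fineK b) h ltxx.
(* Equality almost everywhere makes the two folded integrals coincide at every z. *)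
move=> z; have : (u (r z))%:E = (u z)%:E; last by case.
rewrite (ks_split_reflection H l e1) (ks_split H l e1).
apply: ge0_ae_eq_integral => //.
- by apply: emeasurable_funD; apply: (measurable_ks_term H).
- by apply: emeasurable_funD; apply: (measurable_ks_term H).
- by move=> y _; exact: adde_ge0.
- by move=> y _; exact: adde_ge0.
- apply: negligibleS null' => y /= h; apply: contrapT => nh; apply: h => Sy.
  have -> : u (reflection e l y) `^ beta = u y `^ beta.
    by apply: contrapT => neq; apply: nh.
  by rewrite addeC.
Qed.

Lemma measurable_box (A : 'I_n -> set (measurableTypeR R)) :
  (forall i, measurable (A i)) -> measurable [set x : 'rV[R]_n | forall i, A i (x 0 i)].
Proof.
move=> mA; rewrite (_ : [set x | _] = \bigcap_(i in [set: 'I_n])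
    ((fun x : 'rV[R]_n => x 0%R i : measurableTypeR R) @^-1` A i)).
  apply: fin_bigcap_measurable => // i _.
  by rewrite -[X in measurable X]setTI; exact: measurable_coor.
by apply/seteqP; split => x /= h i; [move=> _; exact: h|exact: (h i I)].
Qed.

(** The integral of u^q over the unit cube is at most that over its translate by [tau *+ k]. The
    translates eventually leave every point, so the latter integrals become arbitrarily small, and
    the positive u^q would have integral 0 over a cube of measure 1. *)
Lemma not_translation_nondecreasing (tau : 'rV[R]_n) :
  tau != 0 -> ~ (forall x, u x <= u (x + tau)).
Proof.
move=> tau0 ule.
have [i taui] : exists i, tau 0 i != 0.
  apply: contrapT => h; move/eqP: tau0; apply; apply/rowP => i; rewrite mxE.
  by apply: contrapT => /eqP ti; apply: h; exists i.
have ulek k x : u x <= u (x + tau *+ k).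
  elim: k => [|k IH]; first by rewrite mulr0n addr0.
  by apply: (le_trans IH); rewrite mulrSr addrA.
pose B := [set x : 'rV[R]_n | forall i, (`[0, 1]%classic : set R) (x 0 i)].
have mB : measurable B.
  by apply: (@measurable_box (fun=> `[0, 1]%classic)) => j; exact: measurable_itv.
have muB : mu B = 1%E.
  rewrite [LHS](lebesgue_rV_box (A := fun=> `[0, 1]%classic)); last first.
    by move=> j; exact: measurable_itv.
  by apply: big1 => j _; rewrite lebesgue_measure_itv/= lte01 oppr0 adde0.
pose E k := [set x | B (x + - (tau *+ k))].
have mE k : measurable (E k).
  have := measurable_rVD (- (tau *+ k)) measurableT mB.
  by rewrite setTI.
pose h := fun x => (u x `^ q)%:E.
have mh : measurable_fun setT h by apply/measurable_EFinP; exact: measurable_ks_pow H _.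
have h_ge0 x : (0 <= h x)%E by exact: ks_pow_ge0.
have q0 : 0 <= q by have := ks_beta1 H; have := ks_betaq H; lra.
have IB k : (\int[mu]_(y in B) h y <= \int[mu]_(y in E k) h y)%E.
  rewrite integral_mkcond [leRHS]integral_mkcond.
  rewrite -(ge0_integral_rVD (tau *+ k) (f := h \_ (E k))); last 2 first.
  - by apply/(measurable_restrictT _ (mE k)); exact: measurable_funTS.
  - by move=> x; apply: erestrict_ge0.
  have mhE : measurable_fun setT (h \_ (E k)).
    by apply/(measurable_restrictT _ (mE k)); exact: measurable_funTS.
  apply: ge0_le_integral => [//|x _|||x _].
  - by apply: erestrict_ge0.
  - by apply/(measurable_restrictT _ mB); exact: measurable_funTS.
  - by apply: measurableT_comp mhE _; exact: measurable_rVD.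
  - rewrite !patchE; case: ifPn => [/set_mem Bx|_]; last by case: ifPn.
    rewrite ifT; last by rewrite inE /E /= addrK.
    by rewrite lee_fin; apply: ge0_ler_powR; rewrite ?nnegrE ?(ltW (ks_u_gt0 H _)).
have I0 : (\int[mu]_(y in B) h y = 0)%E.
  apply/eqP; rewrite eq_le; apply/andP; split; last by apply: integral_ge0.
  apply/lee_addgt0Pr => eta eta0; rewrite add0e.
  have [k Ek] : exists k, (\int[mu]_(y in E k) h y <= eta%:E)%E.
    apply: (ks_vanishing_sets H) => //; apply: aeW => x.
    have ti : 0 < `|tau 0 i| by rewrite normr_gt0.
    have xi : 0 <= (`|x 0 i| + 1) / `|tau 0 i| by rewrite divr_ge0// addr_ge0.
    (* From this index on, [k%:R * tau 0 i] is further than 1 from [x 0 i], so x is outside the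
       translated cube. *)
    exists (Num.Def.archi_bound ((`|x 0 i| + 1) / `|tau 0 i|)) => // k /= Kk Ekx.
    have := Ekx i; rewrite /= in_itv/= !mxE mulmxnE.
    have := archi_boundP xi; rewrite ltr_pdivrMr//.
    set K := Num.Def.archi_bound _ in Kk *.
    have kK : K%:R * `|tau 0 i| <= k%:R * `|tau 0 i| by rewrite ler_wpM2r// ler_nat.
    rewrite -[tau 0 i *+ k]mulr_natl => h0 /andP[h2 h3].
    have := lt_le_trans h0 kK; rewrite -{1}(ger0_norm (ler0n R k)) -normrM => h1.
    have := ler_normB (x 0 i) (x 0 i - k%:R * tau 0 i).
    rewrite opprB addrCA subrr addr0 => h4.
    have : `|x 0 i - k%:R * tau 0 i| <= 1 by rewrite ger0_norm.
    by lra.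
  by apply: le_trans Ek; exact: IB.
have := negligible_integral_eq0 mB (measurable_funTS mh) (fun x _ => h_ge0 x) I0.
move=> /(@negligibleS _ _ _ _ _ B); case.
  move=> x Bx; split => // -[] /eqP; apply/negP.
  by rewrite gt_eqF// (ks_pow_gt0 H).
move=> A [mA A0 BA]; have : (mu B <= mu A)%E by apply: le_measure; rewrite ?inE.
by rewrite muB A0 lee_fin leNgt ltr01.
Qed.

Lemma critical_plane e : dot e e = 1 -> exists l,
  (forall l', l' <= l -> plane_le u e l') /\ (forall x, u (reflection e l x) = u x).
Proof.
move=> e1; pose L := [set l | forall l', l' <= l -> plane_le u e l'].
have e0 : e != 0 by rewrite -dot_eq0 e1 oner_neq0.
have L0 : L !=set0 by have [l Hl] := plane_le_start H e1; exists l.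
have Ldown l l' : L l -> l' <= l -> L l'.
  by move=> Ll l'l m ml; apply: Ll; exact: le_trans l'l.
have Lub : has_ubound L.
  (* Were [L] unbounded, the plane halfway between x and [x + e] would be admissible for every x,
     and u would be nondecreasing along e. *)
  apply: contrapT => nub; apply: (not_translation_nondecreasing e0) => x.
  have [l Ll lx] : exists2 l, L l & dot x e + 2^-1 < l.
    apply: contrapT => h; apply: nub; exists (dot x e + 2^-1) => l Ll.
    by rewrite leNgt; apply/negP => lx; apply: h; exists l.
  have -> : x + e = reflection e (dot x e + 2^-1) x.
    rewrite /reflection; have -> : 2 * (dot x e - (dot x e + 2^-1)) = -1 :> R by field.
    by rewrite scaleN1r opprK.
  by apply: (Ll _ (ltW lx)); rewrite /halfspace /= ltrDl.
have Lsup : has_sup L by [].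
pose s := sup L.
have Llt l : l < s -> L l.
  move=> ls; have [m Lm] := sup_adherent (ltac:(rewrite subr_gt0; exact: ls) : 0 < s - l) Lsup.
  by rewrite -/s opprB addrCA subrr addr0 => /ltW; exact: Ldown.
have Ls : L s.
  move=> l'; rewrite le_eqVlt => /orP[/eqP ->|/Llt]; last exact.
  by apply: (plane_le_closed H e1) => l ls; exact: (Llt l ls l (lexx l)).
exists s; split => //.
apply: (plane_symmetric e1 (Ls s (lexx s))); apply: contrapT => nex.
have [d d0 Hd] : exists2 d : R, 0 < d & forall l', s < l' -> l' < s + d -> plane_le u e l'.
  apply: (plane_le_push H e1) => x Sx; rewrite ltNge; apply/negP => ux.
  by apply: nex; exists x.
have : L (s + d / 2).
  move=> l' l'd; have [l's|sl'] := leP l' s; first exact: Ls.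
  by apply: Hd => //; lra.
by move=> /(sup_upper_bound Lsup); rewrite -/s; lra.
Qed.

End symmetry.

(** * From critical planes to radial symmetry *)

Section radial.
Context (R : realType) n (g : 'rV[R]_n -> \bar R) (u : 'rV[R]_n -> R) (beta q : R).
Hypothesis H : kernel_solution g u beta q.
Implicit Types (x y z e : 'rV[R]_n) (l : R).

Lemma dot_delta x i : dot x (delta_mx 0 i) = x 0 i.
Proof.
rewrite /dot (bigD1 i)//= big1 ?addr0 => [|j ji]; first by rewrite mxE !eqxx mulr1.
by rewrite mxE (negbTE ji) andbF mulr0.
Qed.

(** The reflections in the n coordinate hyperplanes through [x0] compose to the point reflection;
    [flip k] is the stage at which the first k coordinates have been reflected. *)
Lemma central_symmetry x0 :
  (forall i x, u (reflection (delta_mx 0 i) (x0 0 i) x) = u x) ->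
  forall x, u (x0 *+ 2 - x) = u x.
Proof.
move=> sym x; pose flip k : 'rV[R]_n := \row_i if (i < k)%N then 2 * x0 0 i - x 0 i else x 0 i.
have flipE k : (k <= n)%N -> u (flip k) = u x.
  elim: k => [_|k IH kn].
    by congr u; apply/rowP => i; rewrite mxE.
  rewrite -(IH (ltnW kn)) -(sym (Ordinal kn)); congr u; apply/rowP => i.
  rewrite /reflection dot_delta !mxE /= ?ltnSn ?eqxx /=.
  have [->|ik] := eqVneq i (Ordinal kn).
    by rewrite /= ?ltnSn ltnn mulr1; ring.
  rewrite mulr0 subr0 ltnS leq_eqVlt.
  suff -> : (i == k :> nat) = false by [].
  by apply/negbTE; move: ik; apply: contra => /eqP ik; apply/eqP/val_inj.
rewrite -(flipE n (leqnn n)); congr u; apply/rowP => i.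
by rewrite !mxE ltn_ord; ring.
Qed.

Lemma radial_monotone : exists x0, forall x y,
  dot (y - x0) (y - x0) <= dot (x - x0) (x - x0) -> u x <= u y.
Proof.
have ex e : exists l, dot e e = 1 ->
    (forall l', l' <= l -> plane_le u e l') /\ (forall x, u (reflection e l x) = u x).
  have [e1|e1] := pselect (dot e e = 1); last by exists 0.
  by have [l Hl] := critical_plane H e1; exists l.
have {ex} [lam Hlam] := choice ex.
have d1 i : dot (delta_mx 0 i : 'rV[R]_n) (delta_mx 0 i) = 1.
  by rewrite dot_delta mxE !eqxx.
have [x0 csym] : exists x0, forall x, u (x0 *+ 2 - x) = u x.
  exists (\row_i lam (delta_mx 0 i)); apply: central_symmetry => i x.
  by rewrite mxE; have [_] := Hlam _ (d1 i).
(* If the critical plane missed [x0], following its reflection by the point reflection in [x0] would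
   preserve u, and doing so twice is a translation by 4 times the signed distance [d] along e. *)
have lamE e : dot e e = 1 -> lam e = dot x0 e.
  move=> e1; have [_ sym] := Hlam e e1; apply: contrapT => neq.
  pose d := dot x0 e - lam e.
  have d0 : d != 0 by rewrite subr_eq0 eq_sym; apply/eqP.
  have e0 : e != 0 by rewrite -dot_eq0 e1 oner_neq0.
  apply: (not_translation_nondecreasing H (tau := (4 * d) *: e)).
    by rewrite scaler_eq0 negb_or mulf_neq0.
  move=> x; pose s z := x0 *+ 2 - reflection e (lam e) z.
  have us z : u (s z) = u z by rewrite csym sym.
  suff -> : x + (4 * d) *: e = s (s x) by rewrite !us.
  apply/rowP => i; rewrite /s /reflection mulr2n !mxE !dotE e1 /d; ring.
exists x0 => x y xy.
have [->//|nxy] := eqVneq x y.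
have [v vE] : exists v, v = y - x by exists (y - x).
have v0 : 0 < dot v v.
  by rewrite lt_neqAle dot_ge0 andbT eq_sym dot_eq0 vE subr_eq0 eq_sym.
have [s s0 ss] : exists2 s : R, 0 < s & s * s = dot v v.
  exists (Num.sqrt (dot v v)); first by rewrite sqrtr_gt0.
  by rewrite -expr2 sqr_sqrtr// ltW.
have sn0 : s != 0 by rewrite gt_eqF.
have [e eE] : exists e, e = s^-1 *: v by exists (s^-1 *: v).
have e1 : dot e e = 1 by rewrite eE !dotE -ss; field.
have ve : dot v e = s by rewrite eE dotZr -ss; field.
(* The level of the plane bisecting the segment from x to y, with e pointing from x to y, so that x
   lies below it. *)
pose l := (dot x e + dot y e) / 2.
have yxe : dot y e - dot x e = s by rewrite -ve vE !dotE.
have yE : y = reflection e l x.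
  rewrite /reflection; have -> : 2 * (dot x e - l) = - s by rewrite -yxe /l; field.
  by rewrite scaleNr opprK eE scalerA divff// scale1r vE addrCA subrr addr0.
rewrite [X in _ <= u X]yE; apply: (Hlam e e1).1; last by rewrite /halfspace /= /l; lra.
rewrite (lamE e e1).
(* Since y is at least as close to [x0] as x, the point [x0] is not below the bisecting plane, which
   is therefore at or before the critical one. *)
have : 0 <= s * (dot x0 e - l).
  have -> : s * (dot x0 e - l) = (dot (x - x0) (x - x0) - dot (y - x0) (y - x0)) / 2.
    rewrite /l; have -> : s * (dot x0 e - (dot x e + dot y e) / 2) =
      dot x0 v - (dot x v + dot y v) / 2.
      by rewrite eE !dotZr; field.
    by rewrite vE !dotE (dotC x0 x) (dotC x0 y) (dotC y x); field.
  by rewrite divr_ge0// subr_ge0.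
by rewrite pmulr_rge0// subr_ge0.
Qed.

End radial.

(** * Lebesgue measurable functions and null sets *)

Section null_modification.
Context d (T : measurableType d) (R : realType) (mu : {measure set T -> \bar R}).
Local Open Scope ereal_scope.
Import HBNNSimple.

(* No measurability of [f] or [g]: the integral is a supremum over simple functions,
   which may be set to 0 on a null set. *)
Lemma ge0_le_integral_off_null (f g : T -> \bar R) (N : set T) :
  measurable N -> mu N = 0 -> (forall x, 0 <= f x) -> (forall x, 0 <= g x) ->
  (forall x, ~ N x -> f x = g x) -> \int[mu]_x f x <= \int[mu]_x g x.
Proof.
move=> mN N0 f0 g0 fg; rewrite !ge0_integralTE//; apply: ge_ereal_sup => _ [h hf <-].
apply: ereal_sup_ubound; exists (proj_nnsfun h (measurableC mN)).
  move=> x /=; have [Nx|nNx] := pselect (N x).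
    by rewrite /mindic indicE memNset ?mulr0//; apply.
  by rewrite /mindic indicE mem_set// mulr1 -fg// hf.
rewrite -!integralT_nnsfun; apply: ge0_ae_eq_integral => //.
- by apply/measurable_EFinP; exact: measurable_funP.
- by apply/measurable_EFinP; exact: measurable_funP.
- by move=> x _; rewrite lee_fin.
- by move=> x _; rewrite lee_fin.
exists N; split => // x /= nh; apply: contrapT => nN; apply: nh => _ /=.
by rewrite /mindic indicE mem_set// mulr1.
Qed.

Lemma ge0_eq_integral_off_null (f g : T -> \bar R) (N : set T) :
  measurable N -> mu N = 0 -> (forall x, 0 <= f x) -> (forall x, 0 <= g x) ->
  (forall x, ~ N x -> f x = g x) -> \int[mu]_x f x = \int[mu]_x g x.
Proof.
move=> mN N0 f0 g0 fg; apply/eqP; rewrite eq_le; apply/andP; split.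
  exact: (ge0_le_integral_off_null mN).
by apply: (ge0_le_integral_off_null mN) => // x nN; rewrite fg.
Qed.

End null_modification.

(** Rays above rational levels decide measurability, and they are countably many. Each preimage is
    Borel up to a negligible set, and [N] covers all these negligible sets. *)
Lemma lebesgue_measurable_fun_off_null (R : realType) n (u : 'rV[R]_n -> R) :
  lebesgue_measurable_fun u ->
  exists N, [/\ measurable N, lebesgue_rV n N = 0%E & measurable_fun (~` N) u].
Proof.
move=> lu; pose a k : R := ratr (odflt 0 (unpickle k)).
have ex k : exists AN : set 'rV[R]_n * set 'rV[R]_n, [/\ measurable AN.1,
    (lebesgue_rV n).-negligible AN.2 & u @^-1` `]a k, +oo[ = AN.1 `|` AN.2].
  have [A mA [N nN AN]] := lu `]a k, +oo[%classic (measurable_itv _).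
  by exists (A, N).
have {ex} [AN HAN] := choice ex.
have [N [mN N0 subN]] : (lebesgue_rV n).-negligible (\bigcup_k (AN k).2).
  by apply: negligible_bigcup => k; have [] := HAN k.
exists N; split => // mCN.
apply: (measurability _ (RGenOInfty.measurableE R)) => //.
move=> /= _ [_ [c ->] <-].
rewrite (_ : _ `&` _ = \bigcup_(k in [set k | c <= a k]) (~` N `&` (AN k).1)).
  by apply: bigcup_measurable => k _; apply: measurableI => //; have [] := HAN k.
apply/seteqP; split => x /=.
  move=> [nN]; rewrite in_itv/= andbT => /rat_in_itvoo[r]; rewrite in_itv/= => /andP[cr ru].
  have rE : a (pickle r) = ratr r by rewrite /a pickleK.
  exists (pickle r); rewrite /= ?rE ?ltW//; split => //.
  have [_ _ E] := HAN (pickle r).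
  have : (u @^-1` `]a (pickle r), +oo[) x by rewrite /= in_itv/= rE ru.
  by rewrite E => -[//|N'x]; exfalso; apply/nN/subN; exists (pickle r).
move=> [k /= ck [nN Ax]]; split => //; have [_ _ E] := HAN k.
have : (u @^-1` `]a k, +oo[) x by rewrite E; left.
by rewrite /= !in_itv/= !andbT; exact: le_lt_trans.
Qed.

(** * Mixtures of Gaussians as kernels *)

Section gaussian_mixture.
Context (R : realType) (n : nat) (c p : R).
Hypothesis c0 : 0 < c.
Implicit Types (x y z : 'rV[R]_n) (s t : R).

(** For the Bessel kernel [p] is (alpha - n)/2 - 1, which absorbs the measure d delta / delta. The
    indicator lets all integrals run over the whole line. *)
Definition mixture_weight t : R :=
  c * (expR (- (t / (4 * pi))) * t `^ p) * \1_(`]0, +oo[%classic) t.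

Definition mixture_fun s t : R := expR (- (pi * s * t `^ (-1))) * mixture_weight t.

Definition gaussian_mixture x : \bar R :=
  (\int[lebesgue_measure]_t (mixture_fun (dot x x) t)%:E)%E.

Lemma mixture_weight_ge0 t : 0 <= mixture_weight t.
Proof. by rewrite !mulr_ge0 ?expR_ge0 ?powR_ge0// ltW. Qed.

Lemma mixture_weight_gt0 t : 0 < t -> 0 < mixture_weight t.
Proof.
move=> t0; rewrite /mixture_weight indicE mem_set ?mulr1; last by rewrite /= in_itv/= t0.
by rewrite !mulr_gt0 ?expR_gt0 ?powR_gt0.
Qed.

Lemma mixture_weight_eq0 t : t <= 0 -> mixture_weight t = 0.
Proof.
move=> t0; rewrite /mixture_weight indicE memNset ?mulr0//= in_itv/= andbT.
by apply/negP; rewrite -leNgt.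
Qed.

Lemma measurable_mixture_weight : measurable_fun setT mixture_weight.
Proof.
apply: measurable_funM; last by apply: measurable_indic; exact: measurable_itv.
apply: measurable_funM => //; apply: measurable_funM; last exact: measurable_powR.
apply: measurableT_comp => //; apply: measurableT_comp => //.
exact: measurable_funM.
Qed.

Lemma mixture_fun_ge0 s t : 0 <= mixture_fun s t.
Proof. by rewrite mulr_ge0 ?expR_ge0 ?mixture_weight_ge0. Qed.

Lemma measurable_mixture_fun d (T : measurableType d) (f h : T -> R) :
  measurable_fun setT f -> measurable_fun setT h ->
  measurable_fun setT (fun w => mixture_fun (f w) (h w)).
Proof.
move=> mf mh; apply: measurable_funM; last exact: measurableT_comp measurable_mixture_weight mh.
apply: measurableT_comp => //; apply: measurableT_comp => //.
apply: measurable_funM; first exact: measurable_funM.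
exact: measurableT_comp (measurable_powR _) mh.
Qed.

Lemma measurable_mixture_fun_r s : measurable_fun setT (mixture_fun s).
Proof.
apply: (@measurable_mixture_fun _ _ (fun=> s) (fun t => t)).
  exact: measurable_cst.
exact: measurable_id.
Qed.

Lemma mixture_fun_le s s' t : s <= s' -> mixture_fun s' t <= mixture_fun s t.
Proof.
move=> ss'; apply: ler_wpM2r; first exact: mixture_weight_ge0.
rewrite ler_expR lerN2; apply: ler_wpM2r; first exact: powR_ge0.
by apply: ler_wpM2l => //; exact: pi_ge0.
Qed.

Lemma mixture_fun_lt s s' t : s < s' -> 0 < t -> mixture_fun s' t < mixture_fun s t.
Proof.
move=> ss' t0; rewrite ltr_pM2r ?mixture_weight_gt0//.
rewrite ltr_expR ltrN2 ltr_pM2r ?powR_gt0//.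
by rewrite ltr_pM2l// pi_gt0.
Qed.

Local Open Scope ereal_scope.

Lemma gaussian_mixture_ge0 x : 0 <= gaussian_mixture x.
Proof. by apply: integral_ge0 => t _; rewrite lee_fin mixture_fun_ge0. Qed.

Lemma measurable_gaussian_mixture : measurable_fun setT gaussian_mixture.
Proof.
apply: (@measurable_fun_fubini_tonelli_F _ _ _ _ _ lebesgue_measure
  (fun z : 'rV[R]_n * measurableTypeR R => (mixture_fun (dot z.1 z.1) z.2)%:E)).
- apply/measurable_EFinP; apply: measurable_mixture_fun => //.
  by apply: measurable_dot.
- by move=> z; rewrite lee_fin mixture_fun_ge0.
Qed.

Lemma gaussian_mixture_le x y : (dot x x <= dot y y)%R ->
  gaussian_mixture y <= gaussian_mixture x.
Proof.
move=> xy; apply: ge0_le_integral => [//|t _|||t _].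
- by rewrite lee_fin mixture_fun_ge0.
- by apply/measurable_EFinP; exact: measurable_mixture_fun_r.
- by apply/measurable_EFinP; exact: measurable_mixture_fun_r.
- by rewrite lee_fin mixture_fun_le.
Qed.

(** If the two values agreed, finiteness would let them cancel and the difference of the integrands
    would have integral 0, although it is positive for every t > 0. *)
Lemma gaussian_mixture_lt x y : (dot x x < dot y y)%R ->
  gaussian_mixture x < +oo -> gaussian_mixture y < gaussian_mixture x.
Proof.
move=> xy xoo; rewrite lt_neqAle gaussian_mixture_le ?ltW// andbT; apply/eqP => yx.
pose D t := (mixture_fun (dot x x) t - mixture_fun (dot y y) t)%R.
have D_ge0 t : (0 <= D t)%R by rewrite subr_ge0 mixture_fun_le// ltW.
have mD : measurable_fun setT (fun t => (D t)%:E).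
  by apply/measurable_EFinP; apply: measurable_funB; exact: measurable_mixture_fun_r.
have xE : gaussian_mixture x = gaussian_mixture y +
    \int[lebesgue_measure]_t (D t)%:E.
  rewrite /gaussian_mixture -ge0_integralD//.
  - by apply: eq_integral => t _; rewrite -EFinD; congr EFin; rewrite /D; ring.
  - by move=> t _; rewrite lee_fin mixture_fun_ge0.
  - by apply/measurable_EFinP; exact: measurable_mixture_fun_r.
  - by move=> t _; rewrite lee_fin; exact: D_ge0.
have ID : \int[lebesgue_measure]_t (D t)%:E = 0.
  have xfin : gaussian_mixture x \is a fin_num.
    by rewrite ge0_fin_numE// gaussian_mixture_ge0.
  move: xE; rewrite yx -(fineK xfin).
  case: (\int[_]_t _)%E => [a||]//; rewrite -EFinD => -[h].
  by congr EFin; move: h; lra.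
have := @negligible_integral_eq0 _ (measurableTypeR R) R lebesgue_measure setT
  (fun t => (D t)%:E) measurableT mD (fun t _ => D_ge0 t) ID.
move=> [A [mA A0 DA]].
have : lebesgue_measure (`]0%R, 1%R[%classic : set R) <= lebesgue_measure A.
  apply: le_measure; rewrite ?inE//.
  move=> t; rewrite /= in_itv/= => /andP[t0 _]; apply: DA; split => //= -[] /eqP.
  by rewrite gt_eqF// subr_gt0 mixture_fun_lt.
by rewrite A0 lebesgue_measure_itv/= lte_fin ltr01 oppr0 adde0 lee_fin leNgt ltr01.
Qed.

End gaussian_mixture.

(** * Finiteness of Gamma integrals and a weighted Young inequality *)

Section gamma_integral.
Context (R : realType).
Local Notation leb := (@lebesgue_measure R).
Implicit Types (s a t : R).

(** The integrand may blow up at 0, so the antiderivative t^s is used on [1/(k+1), 1] and the bound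
    passes to the increasing limit. *)
Lemma integral_powR_itv01 s : 0 < s ->
  (\int[leb]_(t in `]0%R, 1%R]) (s * t `^ (s - 1))%:E <= 1)%E.
Proof.
move=> s0; pose f t := (s * t `^ (s - 1))%:E.
pose F k := `[k.+1%:R^-1, 1]%classic : set R.
have mf A : measurable_fun A f.
  by apply: measurable_funTS; apply/measurable_EFinP; apply: measurable_funM.
have ndF : {homo F : i j / (i <= j)%N >-> (i <= j)%O}.
  move=> i j ij; apply/subsetPset => t; rewrite /F /= !in_itv/= => /andP[it ->].
  by rewrite andbT (le_trans _ it)// lef_pV2 ?posrE// ler_nat ltnS.
have f_ge0 k t : F k t -> (0 <= f t)%E.
  by move=> _; rewrite lee_fin mulr_ge0 ?powR_ge0// ltW.
have := @ge0_nondecreasing_set_cvg_integral _ (measurableTypeR R) R F f leb ndF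
  (fun=> measurable_itv _) (fun=> mf _) f_ge0.
have -> : \bigcup_k F k = `]0, 1]%classic.
  apply/seteqP; split => t; rewrite /F /=.
    move=> [k _]; rewrite /= !in_itv/= => /andP[kt ->]; rewrite andbT.
    by rewrite (lt_le_trans _ kt)// invr_gt0.
  rewrite in_itv/= => /andP[t0 t1].
  have [k _ Hk] := near_infty_natSinv_lt (PosNum t0).
  by exists k => //=; rewrite in_itv/= t1 andbT ltW//; exact: (Hk k (leqnn k)).
move=> cvgF.
rewrite -(cvg_lim _ cvgF)//; apply: lime_le; first by apply/cvg_ex; eexists; exact: cvgF.
near=> k; rewrite /F.
have k0 : 0 < k.+1%:R^-1 :> R by rewrite invr_gt0.
have k1 : k.+1%:R^-1 < 1 :> R.
  by rewrite invf_lt1// ltr1n ltnS; near: k; exact: nbhs_infty_gt.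
have dpow t : 0 < t -> derivable (@powR R ^~ s) t 1.
  by move=> t0; have [] := is_derive1_powR s t0.
have cpow t r : 0 < t -> {for t, continuous (@powR R ^~ r)}.
  move=> t0; apply: differentiable_continuous; apply/derivable1_diffP.
  by have [] := is_derive1_powR r t0.
rewrite (@continuous_FTC2 _ (fun t => s * t `^ (s - 1)) (@powR R ^~ s))//.
- by rewrite powR1 -EFinB lee_fin lerBlDr lerDl powR_ge0.
- apply: derivable_within_continuous => t; rewrite in_itv/= => /andP[kt _].
  have t0 : 0 < t by exact: lt_le_trans kt.
  by apply: derivableM => //; have [] := is_derive1_powR (s - 1) t0.
- split.
  + move=> t; rewrite in_itv/= => /andP[kt _]; apply: dpow; exact: lt_trans kt.
  + by apply: cvg_at_right_filter; exact: cpow.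
  + by apply: cvg_at_left_filter; exact: cpow.
- move=> t; rewrite in_itv/= => /andP[kt _]; apply: powR_derive1.
  by rewrite in_itv/= andbT; exact: lt_trans kt.
Unshelve. all: by end_near.
Qed.

(** The inequality y <= exp(y) at y = a t / s, raised to the power s. *)
Lemma powR_le_expR s a t : 0 < s -> 0 < a -> 0 < t ->
  t `^ s <= (s / a) `^ s * expR (a * t).
Proof.
move=> s0 a0 t0; have -> : a * t = (a * t / s) * s by field; rewrite gt_eqF.
have sa : 0 < s / a by rewrite divr_gt0.
rewrite expRM -powRM ?expR_ge0//; last exact: ltW.
apply: ge0_ler_powR; rewrite ?nnegrE; [exact: ltW|exact: ltW| |].
  by rewrite mulr_ge0 ?expR_ge0// ltW.
rewrite -ler_pdivrMl// invf_div; apply: le_trans (expR_ge1Dx _).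
have -> : a / s * t = a * t / s by ring.
by rewrite lerDr.
Qed.

(** Up to t = 1 the exponential is dropped. Beyond 1, half of the exponential absorbs the power by
    [powR_le_expR], leaving a multiple of the exponential density of rate a / 2. *)
Lemma gamma_integral_lty s a : 0 < s -> 0 < a ->
  (\int[leb]_t (expR (- (a * t)) * t `^ (s - 1) * \1_(`]0, +oo[%classic) t)%:E < +oo)%E.
Proof.
move=> s0 a0; pose K := (s / (a / 2)) `^ s.
have K0 : 0 <= K by exact: powR_ge0.
have a20 : 0 < a / 2 by rewrite divr_gt0.
pose f1 t := ((s^-1)%:E * ((fun t => (s * t `^ (s - 1))%:E) \_ `]0%R, 1%R]) t)%E.
pose f2 t := ((K / (a / 2))%:E * (exponential_pdf (a / 2) t)%:E)%E.
have mf1' : measurable_fun setT ((fun t => (s * t `^ (s - 1))%:E) \_ `]0%R, 1%R]).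
  apply/(measurable_restrictT _ (measurable_itv _)); apply: measurable_funTS.
  apply/measurable_EFinP; apply: measurable_funM => //; exact: measurable_powR.
have mf2' : measurable_fun setT (fun t => (exponential_pdf (a / 2) t)%:E).
  by apply/measurable_EFinP; exact: measurable_exponential_pdf.
have f1_ge0 t : (0 <= ((fun t => (s * t `^ (s - 1))%:E) \_ `]0%R, 1%R]) t)%E.
  by apply: erestrict_ge0 => {}t _; rewrite lee_fin mulr_ge0 ?powR_ge0// ltW.
have f2_ge0 t : (0 <= (exponential_pdf (a / 2) t)%:E)%E.
  by rewrite lee_fin exponential_pdf_ge0// ltW.
have si0 : (0 <= (s^-1)%:E)%E by rewrite lee_fin invr_ge0 ltW.
have Ka0 : (0 <= (K / (a / 2))%:E)%E by rewrite lee_fin divr_ge0// ltW.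
have mf1 : measurable_fun setT f1 by exact: emeasurable_funM.
have mf2 : measurable_fun setT f2 by exact: emeasurable_funM.
apply: (@le_lt_trans _ _ (\int[leb]_t (f1 t + f2 t))%E).
  apply: ge0_le_integral => [//|t _|||t _].
  - by rewrite lee_fin !mulr_ge0 ?expR_ge0 ?powR_ge0.
  - apply/measurable_EFinP; apply: measurable_funM; last first.
      by apply: measurable_indic; exact: measurable_itv.
    apply: measurable_funM; last exact: measurable_powR.
    apply: measurableT_comp => //; apply: measurableT_comp => //; exact: measurable_funM.
  - exact: emeasurable_funD.
  - have f1t : (0 <= f1 t)%E by exact: mule_ge0.
    have f2t : (0 <= f2 t)%E by exact: mule_ge0.
    have [t0|t0] := leP t 0.
      rewrite indicE memNset ?mulr0 ?adde_ge0//= in_itv/= andbT.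
      by apply/negP; rewrite -leNgt.
    rewrite indicE mem_set ?mulr1; last by rewrite /= in_itv/= t0.
    have [t1|t1] := leP t 1.
      apply: (@le_trans _ _ (f1 t)); last by rewrite leeDl.
      rewrite /f1 patchE mem_set; last by rewrite /= in_itv/= t0.
      rewrite -EFinM lee_fin mulKf ?gt_eqF//; apply: ler_piMl; first exact: powR_ge0.
      by rewrite -expR0 ler_expR oppr_le0 mulr_ge0// ltW.
    apply: (@le_trans _ _ (f2 t)); last by rewrite leeDr.
    rewrite /f2 (exponential_pdfE _ (ltW t0)) -EFinM lee_fin.
    have -> : K / (a / 2) * (a / 2 * expR (- (a / 2) * t)) = K * expR (- (a / 2) * t).
      by field; rewrite !gt_eqF.
    have -> : - (a * t) = - (a / 2) * t - (a / 2) * t by field.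
    rewrite expRD -mulrA [leRHS]mulrC; apply: ler_wpM2l; first exact: expR_ge0.
    rewrite expRN mulrC ler_pdivrMr ?expR_gt0//.
    apply: (@le_trans _ _ (t `^ s)); last exact: powR_le_expR.
    by apply: ler_powR; [exact: ltW|lra].
rewrite ge0_integralD//; last 2 first.
- by move=> t _; exact: mule_ge0.
- by move=> t _; exact: mule_ge0.
rewrite /f1 /f2 (ge0_integralZl leb measurableT mf1' (fun t _ => f1_ge0 t) si0).
rewrite (ge0_integralZl leb measurableT mf2' (fun t _ => f2_ge0 t) Ka0).
rewrite integral_exponential_pdf// mule1 -integral_mkcond.
apply: lte_add_pinfty; last exact: ltry.
apply: lte_mul_pinfty => //; apply: le_lt_trans (integral_powR_itv01 s0) _.
exact: ltry.
Qed.

End gamma_integral.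

(** Young's inequality for the conjugate exponents 1/(1-theta) and 1/theta, without sharp constants.
    According to whether b is at most eta a^r or above it, with r = theta/(1-theta), the first or
    the second term alone dominates a b. *)
Lemma young_split (R : realType) (a b eta theta : R) :
  0 < a -> 0 < b -> 0 < eta -> 0 < theta -> theta < 1 ->
  a * b <= eta * a `^ (1 - theta)^-1 +
    eta `^ (- ((1 - theta) / theta)) * b `^ theta^-1.
Proof.
move=> a0 b0 eta0 th0 th1; pose r := theta / (1 - theta); pose k := (1 - theta) / theta.
have th1' : 0 < 1 - theta by rewrite subr_gt0.
have [thn0 thn1] : theta != 0 /\ 1 - theta != 0 by split; rewrite gt_eqF.
have k0 : 0 < k by rewrite divr_gt0.
have [h|h] := leP b (eta * a `^ r).
  apply: (@le_trans _ _ (eta * a `^ (1 - theta)^-1)); last first.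
    by rewrite lerDl mulr_ge0// powR_ge0.
  have -> : (1 - theta)^-1 = 1 + r by rewrite /r; field.
  rewrite powRD ?(gt_eqF a0) ?implybT// powRr1 ?(ltW a0)// mulrCA.
  by apply: ler_wpM2l => //; exact: ltW.
apply: (@le_trans _ _ (eta `^ (- k) * b `^ theta^-1)); last first.
  by rewrite lerDr mulr_ge0 ?powR_ge0// ltW.
have -> : theta^-1 = k + 1 by rewrite /k; field.
rewrite powRD ?(gt_eqF b0) ?implybT// (powRr1 (ltW b0)) mulrA.
apply: ler_wpM2r; first exact: ltW.
have -> : a = (a `^ r) `^ k.
  rewrite -powRrM (_ : r * k = 1) ?powRr1 ?(ltW a0)//.
  by rewrite /r /k; field; apply/andP.
have -> : eta `^ (- k) = (eta^-1) `^ k.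
  by rewrite -powR_inv1 ?(ltW eta0)// -powRrM mulN1r.
rewrite -powRM ?invr_ge0 ?(ltW eta0) ?(ltW b0)//.
apply: ge0_ler_powR; rewrite ?nnegrE ?powR_ge0//; first exact: ltW.
  by rewrite mulr_ge0 ?invr_ge0 ?(ltW eta0) ?(ltW b0).
by rewrite ler_pdivlMl// ltW.
Qed.

Lemma limn_einf_gt (R : realType) (w : (\bar R)^nat) (a : \bar R) :
  (a < limn_einf w)%E -> \forall k \near \oo, (a < w k)%E.
Proof.
have -> : limn_einf w = ereal_sup (range (einfs w)).
  by rewrite limn_einf_lim; apply/cvg_lim => //; exact: cvg_einfs_sup.
move=> /ereal_sup_gt[_ [N _ <-] aN]; exists N => // k Nk /=; apply: (lt_le_trans aN).
by apply: ereal_inf_lbound; exists k.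
Qed.

(** * Convolution with a mixture: semicontinuity and smallness *)

Section mixture_convolution.
Context (R : realType) (n : nat) (c p : R).
Hypothesis c0 : 0 < c.
Local Notation mu := (@lebesgue_rV R n).
Local Notation leb := (@lebesgue_measure R).
Local Notation K := (@gaussian_mixture R n c p).
Local Notation mf := (mixture_fun c p).
Local Notation mw := (mixture_weight c p).
Implicit Types (x y e : 'rV[R]_n) (b v : 'rV[R]_n -> R) (t : R).

Lemma measurable_mixture_term x b : measurable_fun setT b ->
  measurable_fun setT (fun z : 'rV[R]_n * measurableTypeR R =>
    (mf (dot (x - z.1) (x - z.1)) z.2 * b z.1)%:E).
Proof.
move=> mb; apply/measurable_EFinP; apply: measurable_funM; last exact: measurableT_comp.
apply: measurable_mixture_fun => //; apply: measurable_dot; exact: measurable_subrV.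
Qed.

Lemma mixture_term_ge0 s t (a : R) : 0 <= a -> (0 <= (mf s t * a)%:E)%E.
Proof. by move=> a0; rewrite lee_fin mulr_ge0// mixture_fun_ge0. Qed.

Lemma mixture_convolution_inner x b y : 0 <= b y ->
  (\int[leb]_t (mf (dot (x - y) (x - y)) t * b y)%:E = K (x - y)%R * (b y)%:E)%E.
Proof.
move=> b0; rewrite /gaussian_mixture -ge0_integralZr//.
- by apply/measurable_EFinP; exact: measurable_mixture_fun_r.
- by move=> t _; rewrite lee_fin mixture_fun_ge0.
Qed.

Lemma mixture_convolutionE x b : measurable_fun setT b -> (forall y, 0 <= b y) ->
  (\int[mu]_y (K (x - y)%R * (b y)%:E) =
   \int[mu \x leb]_z (mf (dot (x - z.1) (x - z.1)) z.2 * b z.1)%:E)%E.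
Proof.
move=> mb b0; rewrite fubini_tonelli1; last 2 first.
- exact: measurable_mixture_term.
- by move=> z; exact: mixture_term_ge0.
by apply: eq_integral => y _; rewrite -mixture_convolution_inner.
Qed.

Lemma mixture_convolution_swap x b : measurable_fun setT b -> (forall y, 0 <= b y) ->
  (\int[mu]_y (K (x - y)%R * (b y)%:E) =
   \int[leb]_t \int[mu]_y (mf (dot (x - y) (x - y)) t * b y)%:E)%E.
Proof.
move=> mb b0; rewrite mixture_convolutionE// fubini_tonelli2//.
- exact: measurable_mixture_term.
- by move=> z; exact: mixture_term_ge0.
Qed.

(** The kernel may have a pole, but as an integral over pairs (y, t) the convolution has a
    nonnegative integrand that is continuous in the centre, so Fatou's lemma is applied on the
    product space. *)
Lemma mixture_convolution_lsc b x e (t_ : R^nat) (a : \bar R) :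
  measurable_fun setT b -> (forall y, 0 <= b y) -> t_ @ \oo --> (0 : R) ->
  (a < \int[mu]_y (K (x - y)%R * (b y)%:E))%E ->
  \forall k \near \oo, (a < \int[mu]_y (K (x + t_ k *: e - y)%R * (b y)%:E))%E.
Proof.
move=> mb b0 t0 ax.
pose F k (z : 'rV[R]_n * measurableTypeR R) :=
  (mf (dot (x + t_ k *: e - z.1) (x + t_ k *: e - z.1)) z.2 * b z.1)%:E.
have UE k : (\int[mu]_y (K (x + t_ k *: e - y)%R * (b y)%:E) = \int[mu \x leb]_z F k z)%E.
  exact: mixture_convolutionE.
have mF k : measurable_fun setT (F k) by exact: measurable_mixture_term.
have F_ge0 k z : setT z -> (0 <= F k z)%E by move=> _; exact: mixture_term_ge0.
have Fcvg z : F k z @[k --> \oo] --> (mf (dot (x - z.1) (x - z.1)) z.2 * b z.1)%:E.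
  have scvg : dot (x + t_ k *: e - z.1) (x + t_ k *: e - z.1) @[k --> \oo] -->
      dot (x - z.1) (x - z.1).
    have -> : (fun k => dot (x + t_ k *: e - z.1) (x + t_ k *: e - z.1)) =
        (fun k => dot (x - z.1) (x - z.1) + t_ k * (2 * dot (x - z.1) e) +
          t_ k * t_ k * dot e e).
      apply/funext => k; rewrite !dotE (dotC e x) (dotC e z.1) (dotC z.1 x); ring.
    have E0 : dot (x - z.1) (x - z.1) = dot (x - z.1) (x - z.1) +
        0 * (2 * dot (x - z.1) e) + 0 * 0 * dot e e by ring.
    rewrite [X in _ --> X]E0.
    apply: cvgD; last by apply: cvgM; [exact: cvgM|exact: cvg_cst].
    by apply: cvgD; [exact: cvg_cst|apply: cvgM; [exact: t0|exact: cvg_cst]].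
  apply: cvg_EFin; first exact: nearW.
  apply: (@cvgM _ _ _ _ (fun k => mf (dot (x + t_ k *: e - z.1) (x + t_ k *: e - z.1)) z.2)
    (fun=> b z.1)); last exact: cvg_cst.
  apply: (@cvgM _ _ _ _
    (fun k => expR (- (pi * dot (x + t_ k *: e - z.1) (x + t_ k *: e - z.1) * z.2 `^ (-1))))
    (fun=> mw z.2)); last exact: cvg_cst.
  apply: (cvg_comp (fun k => - (pi * dot (x + t_ k *: e - z.1) (x + t_ k *: e - z.1) *
    z.2 `^ (-1))) expR); last exact: continuous_expR.
  apply: (@cvgN _ R^o); apply: cvgM; last exact: cvg_cst.
  by apply: cvgM; [exact: cvg_cst|exact: scvg].
have Ule : (\int[mu]_y (K (x - y)%R * (b y)%:E) <= limn_einf (fun k => \int[mu \x leb]_z F k z))%E.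
  rewrite (mixture_convolutionE x mb b0).
  apply: (le_trans _ (@fatou _ _ _ (mu \x leb)%E setT measurableT F mF F_ge0)).
  rewrite le_eqVlt; apply/orP; left; apply/eqP; apply: eq_integral => z _.
  by rewrite (cvg_limn_einf_sup (Fcvg z)).1.
apply: filterS (limn_einf_gt (lt_le_trans ax Ule)) => k ak.
by rewrite (UE k).
Qed.

Lemma integral_gaussian_center x (a : R) : 0 < a ->
  (\int[mu]_y (gaussian a (x - y))%:E = ((pi / a) `^ (n%:R / 2))%:E)%E.
Proof.
move=> a0; rewrite -(integral_gaussian n a0).
rewrite -(ge0_integral_rVD (- x) (f := fun y => (gaussian a y)%:E)).
- apply: eq_integral => y _; congr EFin; rewrite /gaussian.
  by rewrite -[x - y]opprB dotNl dotNr opprK.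
- by apply/measurable_EFinP; exact: measurable_gaussian.
- by move=> y; rewrite lee_fin expR_ge0.
Qed.

(** At a fixed t, [young_split] is applied at each y to the Gaussian and [v y]. The Gaussian term is
    integrated over the whole space and the other over [A], where its integral is at most [eta];
    neither bound depends on x. *)
Lemma mixture_slice_le (theta eta0 eta : R) v (A : set 'rV[R]_n) x t :
  0 < theta -> theta < 1 -> 0 < eta0 -> 0 < eta ->
  measurable_fun setT v -> (forall y, 0 < v y) -> measurable A ->
  (\int[mu]_(y in A) (v y `^ theta^-1)%:E <= eta%:E)%E ->
  (\int[mu]_y (mf (dot (x - y) (x - y)) t * (v y * \1_A y))%:E <=
   ((eta0 + eta0 `^ (- ((1 - theta) / theta)) * eta) *
     (mw t * t `^ (n%:R * (1 - theta) / 2)))%:E)%E.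
Proof.
move=> th0 th1 eta00 etap mv v0 mA IA.
have [t0|t0] := leP t 0.
  rewrite integral0_eq; last by move=> y _; rewrite /mixture_fun mixture_weight_eq0// mulr0 mul0r.
  by rewrite mixture_weight_eq0// mul0r mulr0.
pose k := (1 - theta) / theta.
have [r rE] : exists r : R, r = (1 - theta)^-1 by exists (1 - theta)^-1.
have th1' : 0 < 1 - theta by rewrite subr_gt0.
have [thn0 thn1] : theta != 0 /\ 1 - theta != 0 by split; rewrite gt_eqF.
have tn0 : t != 0 by rewrite gt_eqF.
have r0 : 0 < r by rewrite rE invr_gt0.
have r1 : 1 <= r by rewrite rE invf_ge1//; lra.
(* The Young parameter that balances the powers of t: both terms then carry t^(n(1-theta)/2). *)
pose h := eta0 * t `^ (- (n%:R * theta / 2)).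
have h0 : 0 < h by rewrite mulr_gt0// powR_gt0.
have mw0 : 0 <= mw t by exact: mixture_weight_ge0.
pose a := pi * r / t.
have a0 : 0 < a by rewrite divr_gt0// mulr_gt0// pi_gt0.
pose G y := (gaussian a (x - y))%:E.
pose W := (fun y => (v y `^ theta^-1)%:E) \_ A.
have mG : measurable_fun setT G.
  apply/measurable_EFinP; apply: (measurableT_comp (measurable_gaussian a)).
  exact: measurable_subrV.
have mW : measurable_fun setT W.
  apply/(measurable_restrictT _ mA); apply: measurable_funTS; apply/measurable_EFinP.
  exact: (measurableT_comp (measurable_powR _) mv).
have G_ge0 y : (0 <= G y)%E by rewrite lee_fin expR_ge0.
have W_ge0 y : (0 <= W y)%E.
  by apply: erestrict_ge0 => z _; rewrite lee_fin powR_ge0.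
have hE : (0 <= h%:E)%E by rewrite lee_fin ltW.
have hkE : (0 <= (h `^ (- k))%:E)%E by rewrite lee_fin powR_ge0.
have mwE : (0 <= (mw t)%:E)%E by rewrite lee_fin.
have mhG : measurable_fun setT (fun y => h%:E * G y)%E by exact: emeasurable_funM.
have mhW : measurable_fun setT (fun y => (h `^ (- k))%:E * W y)%E by exact: emeasurable_funM.
have mS : measurable_fun setT (fun y => h%:E * G y + (h `^ (- k))%:E * W y)%E.
  exact: emeasurable_funD.
have hG_ge0 y : (0 <= h%:E * G y)%E by exact: mule_ge0.
have hW_ge0 y : (0 <= (h `^ (- k))%:E * W y)%E by exact: mule_ge0.
have S_ge0 y : (0 <= h%:E * G y + (h `^ (- k))%:E * W y)%E by exact: adde_ge0.
apply: (@le_trans _ _ (\int[mu]_y ((mw t)%:E * (h%:E * G y + (h `^ (- k))%:E * W y)))%E).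
  apply: ge0_le_integral => [//|y _|||y _].
  - by apply: mixture_term_ge0; rewrite mulr_ge0// ltW.
  - apply/measurable_EFinP; apply: measurable_funM; last first.
      by apply: measurable_funM => //; exact: measurable_indic.
    apply: measurable_mixture_fun; last exact: measurable_cst.
    by apply: measurable_dot; exact: measurable_subrV.
  - exact: emeasurable_funM.
  - have [Ay|nAy] := pselect (A y); last first.
      by rewrite indicE memNset// !mulr0; exact: mule_ge0.
    have -> : W y = (v y `^ theta^-1)%:E by rewrite /W patchE mem_set.
    rewrite /G indicE mem_set// mulr1.
    rewrite -(EFinM h) -(EFinM (h `^ (- k))) -EFinD -EFinM lee_fin.
    rewrite /mixture_fun -mulrA [leLHS]mulrCA; apply: ler_wpM2l => //.
    have -> : gaussian a (x - y) = expR (- (pi * dot (x - y) (x - y) * t `^ (-1))) `^ r.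
      rewrite -expRM powR_inv1 ?(ltW t0)// /gaussian /a; congr expR; field.
      exact: tn0.
    by rewrite rE; apply: young_split => //; exact: expR_gt0.
rewrite (ge0_integralZl mu measurableT mS (fun y _ => S_ge0 y) mwE).
rewrite (ge0_integralD mu measurableT (fun y _ => hG_ge0 y) mhG (fun y _ => hW_ge0 y) mhW).
rewrite (ge0_integralZl mu measurableT mG (fun y _ => G_ge0 y) hE).
rewrite (ge0_integralZl mu measurableT mW (fun y _ => W_ge0 y) hkE).
rewrite /W -integral_mkcond /G (integral_gaussian_center x a0).
(* Here [pi / a] is [t / r], and [r >= 1]. *)
have Gle : (pi / a) `^ (n%:R / 2) <= t `^ (n%:R / 2).
  have pin0 : pi != 0 :> R by rewrite gt_eqF// pi_gt0.
  have rn0 : r != 0 by rewrite gt_eqF.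
  have divE (P : R) : P != 0 -> P / (P * r / t) = t / r.
    by move=> P0; field; rewrite ?P0 ?rn0 ?tn0.
  rewrite /a (divE _ pin0).
  apply: ge0_ler_powR; rewrite ?nnegrE; [by rewrite divr_ge0|by rewrite divr_ge0// ltW|exact: ltW|].
  by rewrite ler_pdivrMr// ler_peMr// ltW.
apply: (@le_trans _ _ ((mw t)%:E * (h%:E * (t `^ (n%:R / 2))%:E + (h `^ (- k))%:E * eta%:E))%E).
  apply: lee_wpmul2l => //; apply: leeD; apply: lee_wpmul2l => //.
rewrite -(EFinM h) -(EFinM (h `^ (- k))) -EFinD -EFinM lee_fin.
have -> : h * t `^ (n%:R / 2) = eta0 * t `^ (n%:R * (1 - theta) / 2).
  by rewrite /h -mulrA -powRD ?tn0 ?implybT//; congr (_ * _ `^ _); field.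
have -> : h `^ (- k) = eta0 `^ (- k) * t `^ (n%:R * (1 - theta) / 2).
  rewrite /h powRM ?powR_ge0 ?(ltW eta00)// -powRrM; congr (_ * _ `^ _); rewrite /k; field.
  exact: thn0.
by rewrite le_eqVlt; apply/orP; left; apply/eqP; rewrite -/k; ring.
Qed.

(** The slice bounds are integrated over t. The third hypothesis makes the power of t integrable at
    0, and the exponential in the weight takes care of infinity. *)
Lemma mixture_convolution_small (theta : R) v :
  0 < theta -> theta < 1 -> 0 < p + 1 + n%:R * (1 - theta) / 2 ->
  measurable_fun setT v -> (forall y, 0 < v y) ->
  forall eps : R, 0 < eps -> exists2 eta : R, 0 < eta &
    forall A : set 'rV[R]_n, measurable A ->
      (\int[mu]_(y in A) (v y `^ theta^-1)%:E <= eta%:E)%E ->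
      forall x, (\int[mu]_(y in A) (K (x - y)%R * (v y)%:E) <= eps%:E)%E.
Proof.
move=> th0 th1 sig0 mv v0 eps eps0.
pose w := n%:R * (1 - theta) / 2.
pose Q t := (mw t * t `^ w)%:E.
have mQ : measurable_fun setT Q.
  apply/measurable_EFinP; apply: measurable_funM; last exact: measurable_powR.
  exact: measurable_mixture_weight.
have Q_ge0 t : (0 <= Q t)%E by rewrite lee_fin mulr_ge0 ?powR_ge0 ?mixture_weight_ge0.
have QE t : Q t = (c%:E * (expR (- ((4 * pi)^-1 * t)) * t `^ (p + 1 + w - 1) *
    \1_(`]0%R, +oo[%classic) t)%:E)%E.
  have [t0|t0] := leP t 0.
    rewrite /Q mixture_weight_eq0// mul0r indicE memNset ?mulr0 ?mule0//= in_itv/= andbT.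
    by apply/negP; rewrite -leNgt.
  rewrite /Q /mixture_weight -EFinM; congr EFin.
  have -> : p + 1 + w - 1 = p + w by ring.
  rewrite powRD ?(gt_eqF t0) ?implybT// [t / _]mulrC; ring.
have pi4 : 0 < (4 * pi)^-1 :> R by rewrite invr_gt0 mulr_gt0// pi_gt0.
have Qoo : (\int[leb]_t Q t < +oo)%E.
  under eq_integral do rewrite QE.
  rewrite ge0_integralZl//.
  - by apply: lte_mul_pinfty; [rewrite lee_fin ltW|by []|exact: gamma_integral_lty].
  - apply/measurable_EFinP; apply: measurable_funM; last first.
      by apply: measurable_indic; exact: measurable_itv.
    apply: measurable_funM; last exact: measurable_powR.
    by apply: measurableT_comp => //; apply: measurableT_comp => //; exact: measurable_funM.
  - by move=> t _; rewrite lee_fin !mulr_ge0 ?expR_ge0 ?powR_ge0.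
  - by rewrite lee_fin ltW.
have IQ_ge0 : (0 <= \int[leb]_t Q t)%E by apply: integral_ge0 => t _; exact: Q_ge0.
have [C C0 CE] : exists2 C : R, 0 <= C & (\int[leb]_t Q t = C%:E)%E.
  have fin : (\int[leb]_t Q t)%E \is a fin_num by rewrite ge0_fin_numE.
  by exists (fine (\int[leb]_t Q t)%E); [exact: fine_ge0|rewrite fineK].
pose k := (1 - theta) / theta.
(* With the [eta] below, the two terms of the slice bound are equal, so the total is [2 * eta0 * C],
   at most [eps]. Adding 1 to [C] avoids a zero denominator. *)
pose eta0 := eps / (2 * (C + 1)).
have C1 : 0 < C + 1 by lra.
have eta00 : 0 < eta0 by rewrite divr_gt0// mulr_gt0.
pose eta := eta0 * eta0 `^ k.
have etap : 0 < eta by rewrite mulr_gt0// powR_gt0.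
exists eta => // A mA IA x.
pose vA y := v y * \1_A y.
have vA_ge0 y : 0 <= vA y by rewrite mulr_ge0// ltW.
have mvA : measurable_fun setT vA by apply: measurable_funM => //; exact: measurable_indic.
have -> : (\int[mu]_(y in A) (K (x - y)%R * (v y)%:E) = \int[mu]_y (K (x - y)%R * (vA y)%:E))%E.
  rewrite integral_mkcond; apply: eq_integral => y _; rewrite patchE /vA indicE.
  by case: ifPn => _; rewrite ?mulr1 ?mulr0 ?mule0.
rewrite (mixture_convolution_swap x mvA vA_ge0).
apply: (@le_trans _ _ (\int[leb]_t ((2 * eta0)%:E * Q t))%E).
  apply: ge0_le_integral => [//|t _|||t _].
  - by apply: integral_ge0 => y _; exact: mixture_term_ge0.
  - apply: (measurable_fun_fubini_tonelli_G (m1 := mu)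
      (fun z : 'rV[R]_n * measurableTypeR R => (mf (dot (x - z.1) (x - z.1)) z.2 * vA z.1)%:E)).
      exact: measurable_mixture_term.
    by move=> z; exact: mixture_term_ge0.
  - exact: emeasurable_funM.
  - have -> : 2 * eta0 = eta0 + eta0 `^ (- k) * eta.
      have E1 : eta0 `^ (- k) * eta0 `^ k = 1.
        rewrite -powRD; first by rewrite addNr powRr0.
        by rewrite (gt_eqF eta00) implybT.
      by rewrite /eta [X in _ + X]mulrCA E1 mulr1 mulrDl mul1r.
    rewrite /Q -EFinM.
    exact: (mixture_slice_le x t th0 th1 eta00 etap mv v0 mA IA).
rewrite ge0_integralZl//; last by rewrite lee_fin mulr_ge0// ltW.
rewrite CE -EFinM lee_fin.
have -> : 2 * eta0 * C = eps * (C / (C + 1)) by rewrite /eta0; field; rewrite gt_eqF.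
by rewrite ler_piMr ?(ltW eps0)// ler_pdivrMr// mul1r lerDl.
Qed.

End mixture_convolution.

(** * The Bessel kernel and the conclusion *)

Lemma bessel_gamma_ge0 (R : realType) (alpha : R) : 0 <= bessel_gamma alpha.
Proof.
rewrite mulr_ge0 ?powR_ge0//; apply: fine_ge0; apply: integral_ge0 => t _.
by rewrite lee_fin mulr_ge0 ?powR_ge0 ?expR_ge0.
Qed.

Lemma bessel_kernel_mixture (R : realType) n (alpha : R) :
  0 < (bessel_gamma alpha)^-1 ->
  @bessel_kernel R n alpha =
  gaussian_mixture (bessel_gamma alpha)^-1 ((- n%:R + alpha) / 2 - 1).
Proof.
move=> c0; apply/funext => x; rewrite /bessel_kernel integral_mkcond.
set c := (bessel_gamma alpha)^-1 in c0 *; set p := _ / 2 - 1.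
have -> : (fun delta : R => (expR (- (pi * enorm x ^+ 2 / delta)) *
     expR (- (delta / (4 * pi))) * delta `^ ((- n%:R + alpha) / 2) / delta)%:E) \_ `]0, +oo[ =
    (fun t => (mixture_fun 1 p (dot x x) t)%:E).
  apply/funext => t; rewrite patchE; case: ifPn => [/set_mem|/negP].
    rewrite /= in_itv/= andbT => t0; congr EFin.
    rewrite /mixture_fun /mixture_weight indicE mem_set ?mulr1 ?mul1r; last first.
      by rewrite /= in_itv/= t0.
    rewrite enorm_sqr powR_inv1 ?(ltW t0)// /p powRB ?(gt_eqF t0) ?implybT//.
    by rewrite powRr1 ?(ltW t0)// !mulrA.
  rewrite inE /= in_itv/= andbT => /negP; rewrite -leNgt => t0.
  by rewrite /mixture_fun mixture_weight_eq0// mulr0.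
rewrite -ge0_integralZl//.
- apply: eq_integral => t _; rewrite -EFinM; congr EFin.
  by rewrite /mixture_fun /mixture_weight; ring.
- by apply/measurable_EFinP; exact: measurable_mixture_fun_r.
- by move=> t _; rewrite lee_fin mixture_fun_ge0.
- by rewrite lee_fin ltW.
Qed.

Lemma finite_norm_powR_lty (R : realType) n (q : R) (u : 'rV[R]_n -> R) :
  0 < q -> (forall x, 0 < u x) -> finite_norm (lebesgue_rV n) q%:E u ->
  (\int[lebesgue_rV n]_y (u y `^ q)%:E < +oo)%E.
Proof.
move=> q0 u0; rewrite /finite_norm Lnorm.unlock /=.
have -> : (\int[lebesgue_rV n]_x `|(u x)%:E| `^ q = \int[lebesgue_rV n]_x (u x `^ q)%:E)%E.
  by apply: eq_integral => x _; rewrite gee0_abs ?lee_fin ?ltW// poweR_EFin.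
set I := (\int[_]_y _)%E => h; rewrite ltNge leye_eq; apply/negP => /eqP Ioo.
by move: h; rewrite Ioo poweRyr ?ltxx// gt_eqF// invr_gt0.
Qed.

(** Under the integral u may be replaced by a Borel function equal to it off a null set. The
    equation then exhibits u, at every point, as a convolution of Borel functions. *)
Lemma mixture_solution_measurable (R : realType) n (c p beta : R) (u : 'rV[R]_n -> R) :
  0 < c -> lebesgue_measurable_fun u ->
  (forall x, (u x)%:E =
    \int[lebesgue_rV n]_y (gaussian_mixture c p (x - y)%R * (u y `^ beta)%:E))%E ->
  measurable_fun setT u.
Proof.
move=> c0 lu uE; have [N [mN N0 mu]] := lebesgue_measurable_fun_off_null lu.
pose v := u \_ (~` N).
have mv : measurable_fun setT v by apply/(measurable_restrictT _ (measurableC mN)).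
pose F (z : 'rV[R]_n * 'rV[R]_n) := (gaussian_mixture c p (z.1 - z.2)%R * (v z.2 `^ beta)%:E)%E.
have term_ge0 (x : 'rV[R]_n) (a : R) : (0 <= gaussian_mixture c p x * (a `^ beta)%:E)%E.
  by apply: mule_ge0; [exact: gaussian_mixture_ge0|rewrite lee_fin powR_ge0].
have mF : measurable_fun setT F.
  apply: emeasurable_funM.
    apply: (measurableT_comp (@measurable_gaussian_mixture R n c p c0)).
    exact: measurable_subrV.
  apply/measurable_EFinP; apply: (measurableT_comp (measurable_powR beta)).
  exact: measurableT_comp.
apply/measurable_EFinP.
have -> : EFin \o u = fubini_F (lebesgue_rV n) F.
  apply/funext => x; rewrite /fubini_F /F /= uE.
  apply: (ge0_eq_integral_off_null mN N0) => [y|y|y nNy].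
  - exact: term_ge0.
  - exact: term_ge0.
  - by rewrite /v patchE mem_set.
by apply: measurable_fun_fubini_tonelli_F => // z; exact: term_ge0.
Qed.

Lemma mixture_kernel_solution (R : realType) n (c p beta q : R) (u : 'rV[R]_n -> R) :
  0 < c -> 1 < beta -> beta < q -> 0 < p + 1 + n%:R * (1 - (beta - 1) / q) / 2 ->
  lebesgue_measurable_fun u -> (forall x, 0 < u x) ->
  (\int[lebesgue_rV n]_y (u y `^ q)%:E < +oo)%E ->
  (forall x, (u x)%:E =
    \int[lebesgue_rV n]_y (gaussian_mixture c p (x - y)%R * (u y `^ beta)%:E))%E ->
  kernel_solution (gaussian_mixture c p) u beta q.
Proof.
move=> c0 b1 bq sig lu u0 uq uE; have mu := mixture_solution_measurable c0 lu uE.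
have mpow r : measurable_fun setT (fun y => u y `^ r).
  exact: (measurableT_comp (measurable_powR r) mu).
constructor => //.
- exact: measurable_gaussian_mixture.
- exact: gaussian_mixture_ge0.
- exact: gaussian_mixture_le.
- exact: gaussian_mixture_lt.
- have q0 : 0 < q by lra.
  (* This theta turns the power 1/theta of u^(beta-1) into u^q. *)
  have th0 : 0 < (beta - 1) / q by rewrite divr_gt0// subr_gt0.
  have th1 : (beta - 1) / q < 1 by rewrite ltr_pdivrMr//; lra.
  move=> eps eps0; have [eta eta0 small] := mixture_convolution_small c0 th0 th1 sig
    (mpow (beta - 1)) (fun y => powR_gt0 (beta - 1) (u0 y)) eps0.
  exists eta; [exact: eta0|move=> A mA IA x; apply: (small A mA _ x)].
  have -> : (\int[lebesgue_rV n]_(y in A) ((u y `^ (beta - 1)) `^ ((beta - 1) / q)^-1)%:E =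
      \int[lebesgue_rV n]_(y in A) (u y `^ q)%:E)%E.
    apply: eq_integral => y _; rewrite -powRrM; congr ((_ `^ _)%:E); field.
    by rewrite !gt_eqF// subr_gt0.
  exact: IA.
- move=> x e t a t0 au.
  have ax : (a%:E < \int[lebesgue_rV n]_y (gaussian_mixture c p (x - y)%R * (u y `^ beta)%:E))%E.
    by rewrite -(uE x) lte_fin.
  have := @mixture_convolution_lsc R n c p c0 (fun y => u y `^ beta) x e t a%:E
    (mpow beta) (fun y => powR_ge0 _ _) t0 ax.
  by apply: filterS => k; rewrite -(uE (x + t k *: e)) lte_fin.
Qed.

Theorem theorem1 (R : realType) (n : nat) (alpha beta q : R)
    (u : 'rV[R]_n -> R) :
  (1 <= n)%N -> 0 < alpha -> 1 < beta ->
  Num.max beta (n%:R * (beta - 1) / alpha) < q ->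
  in_Lp q u -> positive_solution alpha beta u ->
  exists (x0 : 'rV[R]_n) (phi : R -> R),
    (forall r s : R, r <= s -> phi s <= phi r) /\
    (forall x : 'rV[R]_n, u x = phi (enorm (x - x0))).
Proof.
move=> n1 alpha0 b1; rewrite gt_max => /andP[bq nq] [lu uLq] [_ u0 uE].
have q0 : 0 < q by lra.
(* If this constant were 0, the kernel and hence u would vanish, against the positivity of u. *)
have c0 : 0 < (bessel_gamma alpha)^-1.
  rewrite lt_neqAle invr_ge0 bessel_gamma_ge0 andbT eq_sym; apply/eqP => cE.
  have := u0 0; rewrite -lte_fin uE /convolution integral0_eq ?ltxx// => y _.
  by rewrite /bessel_kernel cE !mul0e.
rewrite /convolution bessel_kernel_mixture// in uE.
have H : kernel_solution (gaussian_mixture (bessel_gamma alpha)^-1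
    ((- n%:R + alpha) / 2 - 1)) u beta q.
  apply: mixture_kernel_solution => //; last exact: finite_norm_powR_lty.
  (* The exponent at t = 0 is positive exactly when [q > n * (beta - 1) / alpha]. *)
  have -> : (- n%:R + alpha) / 2 - 1 + 1 + n%:R * (1 - (beta - 1) / q) / 2 =
      (alpha - n%:R * (beta - 1) / q) / 2 by field; rewrite gt_eqF.
  rewrite divr_gt0// subr_gt0 ltr_pdivrMr// [alpha * q]mulrC.
  by rewrite -ltr_pdivrMr.
have [x0 mono] := radial_monotone H.
case: n n1 u alpha0 nq lu uLq u0 uE x0 mono H => // n _ u _ _ _ _ _ _ x0 mono _.
pose e : 'rV[R]_n.+1 := delta_mx 0 ord0.
have max_ge0 (r : R) : 0 <= Num.max r 0 by rewrite le_max lexx orbT.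
(* The profile of u on a ray from [x0], in a coordinate direction available because n >= 1. The
   maximum extends it by a constant to negative r, which keeps it monotone on the whole line. *)
pose phi (r : R) := u (x0 + Num.max r 0 *: e).
have norm_phi (r : R) : dot (x0 + Num.max r 0 *: e - x0) (x0 + Num.max r 0 *: e - x0) =
    Num.max r 0 ^+ 2.
  by rewrite addrAC subrr add0r dotZl dotZr dot_delta mxE !eqxx mulr1 expr2.
exists x0, phi; split => [r s rs|x].
  apply: mono; rewrite !norm_phi ler_sqr ?nnegrE//.
  by rewrite ge_max !le_max rs lexx orbT.
have xE : dot (x - x0) (x - x0) = Num.max (enorm (x - x0)) 0 ^+ 2.
  by rewrite (max_idPl _) ?enorm_sqr// sqrtr_ge0.
by apply/eqP; rewrite eq_le; apply/andP; split; apply: mono; rewrite norm_phi xE.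
Qed.
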